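(* Let $k$ be an algebraically closed field of characteristic $p>3$, and let $E$ be the (complete) elliptic curve defined locally by $\zeta^2=4\xi^3+1$, with the derivation $D_E$ for which $D_E(\xi)=\zeta$. Let $D_0$ and $D_1$ be the derivations on $E\times E$ induced by $D_E$ on the first and second factors. For $\lambda\in k$, let $\mathcal{G}_\lambda$ be the foliation on $E\times E$ generated by $D_0+\lambda D_1$. For $\alpha\in k$, let $\lambda=\frac13(1+2\omega)(1-\alpha)\in k$ for a primitive cubic root of unity $\omega\in k$. Then $\mathcal{F}^4_\alpha$ is birationally equivalent to the quotient of $\mathcal{G}_\lambda$ under the action of the transformation of order three of $E\times E$ given by $$(\xi_0,\zeta_0,\xi_1,\zeta_1)\mapsto(\omega^2\xi_0,\zeta_0,\omega^2\xi_1,\zeta_1).$$ In particular, $\mathcal{F}^4_\alpha$ is algebraically integrable if and only if so is $\mathcal{G}_\lambda$.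
   Context: $(\xi_i,\zeta_i)$, $i=0,1$, are the affine coordinates on the two factors of $E\times E$, with $\zeta_i^2=4\xi_i^3+1$. For $\alpha\in k$, $\mathcal{F}^4_\alpha$ is the foliation on $\mathbf{P}^2_k$ given by the kernel of $(y^3-z^3)(yz-\alpha x^2)\,dx+(z^3-x^3)(xz-\alpha y^2)\,dy+(x^3-y^3)(xy-\alpha z^2)\,dz$. A foliation on a surface over $k$ is algebraically integrable if there is a rational function $f$ (a rational first integral) with $df\neq0$ whose differential has the foliation as kernel on a dense open subset. *)

(* Defs.v *)
From HB Require Import structures.
From mathcomp Require Import all_boot all_order all_algebra.
From mathcomp Require Import mpoly.

Set Implicit Arguments.
Unset Strict Implicit.
Unset Printing Implicit Defensive.

Import GRing.Theory.
Local Open Scope ring_scope.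

(* Foliated surfaces up to birational equivalence are described through their *)
(* function fields.  A foliation on a surface S over k is determined by its   *)
(* restriction to any dense open subset, i.e. by its generic stalk, which is  *)
(* a one-dimensional K-subspace of Der_k(K) for K = k(S).                     *)

Record kfield (k : fieldType) := KField {
  kf_sort :> fieldType;
  kf_const : {rmorphism k -> kf_sort}
}.
Notation "c %:K" := (kf_const _ c) (at level 2, left associativity, format "c %:K").

Record kmorph (k : fieldType) (K L : kfield k) := KMorph {
  kmorph_fun :> {rmorphism K -> L};
  kmorph_const : forall c : k, kmorph_fun c%:K = c%:K
}.

Record derivation (k : fieldType) (K : kfield k) := Derivation {
  der_fun :> K -> K;
  derD : forall f g, der_fun (f + g) = der_fun f + der_fun g;
  derM : forall f g, der_fun (f * g) = f * der_fun g + g * der_fun f;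
  der_const : forall c : k, der_fun c%:K = 0
}.

(* K is the function field of the irreducible algebraic subset X of the       *)
(* affine n-space over the algebraically closed field k, with coordinate      *)
(* functions a: a polynomial in the coordinate functions vanishes in K iff it *)
(* vanishes at all the k-points of X, and K = k(a).                           *)
Definition function_field (k : closedFieldType) (n : nat)
    (X : n.-tuple k -> Prop) (K : kfield k) (a : n.-tuple K) : Prop :=
  (forall P : {mpoly k[n]},
     mmap (@kf_const k K) (tnth a) P = 0 <->
     (forall x : n.-tuple k, X x -> P.@[tnth x] = 0)) /\
  (forall f : K, exists P Q : {mpoly k[n]},
     mmap (@kf_const k K) (tnth a) Q != 0 /\
     f = mmap (@kf_const k K) (tnth a) P / mmap (@kf_const k K) (tnth a) Q).

(* The chart z <> 0 of P^2, with coordinates u = x / z and v = y / z. *)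
Definition P2_chart (k : fieldType) (x : 2.-tuple k) : Prop := True.

Definition on_E (k : fieldType) (xi zeta : k) : Prop :=
  zeta ^+ 2 = 4%:R * xi ^+ 3 + 1.

(* The complement in E x E of the points at infinity of the two factors. *)
Definition ExE_chart (k : fieldType) (x : 4.-tuple k) : Prop :=
  on_E x`_0 x`_1 /\ on_E x`_2 x`_3.

Section Foliations.
Variable k : fieldType.

Definition is_foliation (K : kfield k) (F : derivation K -> Prop) : Prop :=
  exists2 D0 : derivation K, (exists f, D0 f != 0) &
    forall D : derivation K, F D <-> exists h : K, forall f, D f = h * D0 f.

(* The differential df is identified with the functional D |-> D f on         *)
(* Der_k(K), the dual of the module of differentials.                         *)
Definition algebraically_integrable (K : kfield k)
    (F : derivation K -> Prop) : Prop :=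
  exists f : K, (exists D : derivation K, D f != 0) /\
    (forall D : derivation K, F D <-> D f = 0).

(* The isomorphism phi transports F to G: D belongs to F iff                  *)
(* phi \o D \o phi^-1 belongs to G.                                           *)
Definition transports (K L : kfield k) (phi : kmorph K L)
    (F : derivation K -> Prop) (G : derivation L -> Prop) : Prop :=
  bijective phi /\
  forall (D : derivation K) (D' : derivation L),
    (forall f, D' (phi f) = phi (D f)) -> (F D <-> G D').

Definition birationally_equivalent (K L : kfield k)
    (F : derivation K -> Prop) (G : derivation L -> Prop) : Prop :=
  exists phi : kmorph K L, transports phi F G.

End Foliations.

(* The field of invariant rational functions, i.e. the function field of the  *)
(* quotient of the surface by the group generated by s.                       *)
Section Quotient.
Variables (k : fieldType) (K : kfield k) (s : kmorph K K).

Definition invariant : {pred K} := [pred f | s f == f].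

Fact invariant_divring_closed : divring_closed invariant.
Proof.
split; rewrite ?inE ?rmorph1 //.
- by move=> f g; rewrite !inE => /eqP sf /eqP sg; rewrite rmorphB /= sf sg.
- by move=> f g; rewrite !inE => /eqP sf /eqP sg; rewrite fmorph_div sf sg.
Qed.

HB.instance Definition _ :=
  GRing.isDivringClosed.Build K invariant invariant_divring_closed.

Record quotient_field := QuotientField {
  quotient_val : K;
  _ : quotient_val \in invariant
}.

HB.instance Definition _ := [isSub for quotient_val].
HB.instance Definition _ := [Choice of quotient_field by <:].
HB.instance Definition _ :=
  [SubChoice_isSubIntegralDomain of quotient_field by <:].
HB.instance Definition _ :=
  [SubIntegralDomain_isSubField of quotient_field by <:].

Fact const_invariant (c : k) : c%:K \in invariant.
Proof. by rewrite inE kmorph_const. Qed.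

Definition quotient_const (c : k) : quotient_field :=
  QuotientField (const_invariant c).

Fact quotient_const_additive : zmod_morphism quotient_const.
Proof. by move=> c d; apply: val_inj; rewrite /= rmorphB. Qed.

Fact quotient_const_multiplicative : monoid_morphism quotient_const.
Proof. by split=> [|c d]; apply: val_inj; rewrite /= ?rmorph1 ?rmorphM. Qed.

HB.instance Definition _ :=
  GRing.isZmodMorphism.Build k quotient_field quotient_const
    quotient_const_additive.
HB.instance Definition _ :=
  GRing.isMonoidMorphism.Build k quotient_field quotient_const
    quotient_const_multiplicative.

Definition quotient_kfield : kfield k := @KField k quotient_field quotient_const.

(* The vector fields on the quotient that lift to vector fields tangent to F. *)
Definition quotient_foliation (F : derivation K -> Prop) :
    derivation quotient_kfield -> Prop :=
  fun d => exists2 D : derivation K, F D &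
    forall f : quotient_kfield, D (quotient_val f) = quotient_val (d f).

End Quotient.

(* In the chart z = 1 of P^2 the homogeneous coordinates of the generic point *)
(* are (u : v : 1); the 1-form vanishes on the Euler field, so it descends to *)
(* P^2 and its kernel may be computed with this representative.               *)
Definition foliation_F4 (k : fieldType) (L : kfield k) (u v : L) (alpha : k) :
    derivation L -> Prop :=
  fun D => let: x := u in let: y := v in let: z := 1 : L in
    (y ^+ 3 - z ^+ 3) * (y * z - alpha%:K * x ^+ 2) * D x +
    (z ^+ 3 - x ^+ 3) * (x * z - alpha%:K * y ^+ 2) * D y +
    (x ^+ 3 - y ^+ 3) * (x * y - alpha%:K * z ^+ 2) * D z = 0.

(* D acts as D_E on the functions of the factor with coordinates (xi, zeta)   *)
(* and kills those of the factor with coordinates (xi', zeta').  The value    *)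
(* D zeta = 6 xi^2 is forced by D xi = zeta and the equation of E.            *)
Definition induced_by_DE (k : fieldType) (K : kfield k)
    (xi zeta xi' zeta' : K) (D : derivation K) : Prop :=
  [/\ D xi = zeta, D xi' = 0 & D zeta' = 0].

(* D_0 and D_1 below are unique, since the coordinates generate K over k. *)
Definition foliation_G (k : fieldType) (K : kfield k)
    (xi0 zeta0 xi1 zeta1 : K) (lambda : k) : derivation K -> Prop :=
  fun D => exists D0 D1 : derivation K,
    [/\ induced_by_DE xi0 zeta0 xi1 zeta1 D0,
        induced_by_DE xi1 zeta1 xi0 zeta0 D1 &
        exists h : K, forall f, D f = h * (D0 f + lambda%:K * D1 f)].

(* The action on functions, f |-> f \o T, of the transformation T that maps   *)
(* (xi0, zeta0, xi1, zeta1) to (w^2 xi0, zeta0, w^2 xi1, zeta1).              *)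
Definition order3_action (k : fieldType) (K : kfield k)
    (xi0 zeta0 xi1 zeta1 : K) (w : k) (s : kmorph K K) : Prop :=
  [/\ s xi0 = (w ^+ 2)%:K * xi0, s zeta0 = zeta0,
      s xi1 = (w ^+ 2)%:K * xi1 & s zeta1 = zeta1].

(* Main.v *)
(* Let S = x^2 y + y^2 z + z^2 x and T = x y^2 + y z^2 + z x^2. Each of the cubics
   y^3 - z^3, z^3 - x^3, x^3 - y^3 of one pencil, and T - S, T - w S, T - w^2 S of
   another, is a union of three lines, and both triples use the same nine lines.
   Sending either triple to the branch values 1, -1 and infinity of zeta : E -> P^1
   gives the map from P^2 to the quotient of E x E:
     zeta0 = (x^3 + y^3 - 2 z^3) / (x^3 - y^3),
     zeta1 = (1 + 2 w) (T + S) / (S - T),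
     xi0 / xi1 = (T - S) / (x^3 - y^3),
   where the third value is consistent with the equation of E because T^3 - S^3 and
   (x^3 - y^3)(y^3 - z^3)(z^3 - x^3) are both the product of the nine lines. This
   map is invertible (see surf_u and surf_v), and it pulls back the form
   (xi0 / xi1)^2 dzeta1 - lambda dzeta0 to a multiple of the one defining F^4_alpha.
   K is generated over the invariants by xi1, whose cube is invariant; hence every
   derivation of the quotient lifts to K. A first integral f of G yields one of F
   among the cubes of the Lagrange resolvents f + c sigma f + c^2 sigma^2 f, c^3 = 1. *)

Require Import Defs.
From HB Require Import structures.
From mathcomp Require Import all_boot all_order all_algebra.
From mathcomp Require Import mpoly ring.

Set Implicit Arguments.
Unset Strict Implicit.
Unset Printing Implicit Defensive.

Import GRing.Theory.
Local Open Scope ring_scope.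

(** * Polynomials vanishing everywhere *)

Lemma mpoly_ring_ind (n : nat) (R : comNzRingType) (P : {mpoly R[n]} -> Prop) :
    (forall c, P c%:MP) -> (forall i, P 'X_i) ->
    (forall p q, P p -> P q -> P (p + q)) ->
    (forall p q, P p -> P q -> P (p * q)) ->
  forall p, P p.
Proof.
move=> PC PX PD PM p; rewrite [p]mpolyE.
elim/big_ind: _ => [||m _]; [by rewrite -mpolyC0 | exact: PD |].
rewrite -mul_mpolyC; apply: (PM _ _ (PC _)); rewrite mpolyXE_id.
elim/big_ind: _ => [||i _]; [exact: (PC 1) | exact: PM |].
by elim: (m i) => [|j IHj]; [exact: (PC 1) | rewrite exprS; exact: PM].
Qed.

Lemma mmapXU (n : nat) (R S : comNzRingType) (f : {rmorphism R -> S})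
  (h : 'I_n -> S) (i : 'I_n) : mmap f h 'X_i = h i.
Proof. by rewrite mmapX mmap1U. Qed.

Lemma mpoly_rmorph_eq (n : nat) (R S : comNzRingType)
    (f g : {rmorphism {mpoly R[n]} -> S}) :
  (forall c, f c%:MP = g c%:MP) -> (forall i, f 'X_i = g 'X_i) -> f =1 g.
Proof.
move=> fgC fgX; elim/mpoly_ring_ind=> // p q; first by rewrite !rmorphD => -> ->.
by rewrite !rmorphM => -> ->.
Qed.

Section FirstVariable.
Variables (n : nat) (R : comNzRingType).

(** Singles out the variable [ord0], with coefficients in the remaining variables, to allow
    induction on the number of variables. *)
Definition first_var_poly : {mpoly R[n.+1]} -> {poly {mpoly R[n]}} :=
  mmap (polyC \o @mpolyC n R)
       (fun i => if unlift ord0 i is Some j then ('X_j)%:P else 'X).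

HB.instance Definition _ := GRing.RMorphism.on first_var_poly.

Lemma first_var_polyC c : first_var_poly c%:MP = c%:MP%:P.
Proof. exact: mmapC. Qed.

Lemma first_var_polyX0 : first_var_poly 'X_ord0 = 'X.
Proof. by rewrite /first_var_poly mmapXU unlift_none. Qed.

Lemma first_var_polyXS j : first_var_poly 'X_(lift ord0 j) = ('X_j)%:P.
Proof. by rewrite /first_var_poly mmapXU liftK. Qed.

(** A left inverse renames the variables of the coefficients along [lift ord0], then evaluates at
    ['X_ord0]. *)
Lemma first_var_poly_inj : injective first_var_poly.
Proof.
pose h : {mpoly R[n]} -> {mpoly R[n.+1]} :=
  mmap (@mpolyC n.+1 R) (fun j => 'X_(lift ord0 j)).
pose h' : {rmorphism _ -> _} := h.
pose g : {rmorphism {mpoly R[n.+1]} -> {mpoly R[n.+1]}} :=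
  horner_eval 'X_ord0 \o map_poly h' \o first_var_poly.
have gK : g =1 idfun.
  apply: mpoly_rmorph_eq => [c|i]; rewrite /= /horner_eval.
    by rewrite first_var_polyC map_polyC hornerC /= /h mmapC.
  case: (unliftP ord0 i) => [j|] ->.
    by rewrite first_var_polyXS map_polyC hornerC /= /h mmapXU.
  by rewrite first_var_polyX0 map_polyX hornerX.
exact: (can_inj (g := horner_eval 'X_ord0 \o map_poly h') gK).
Qed.

Lemma first_var_poly_eval (v : 'I_n.+1 -> R) (p : {mpoly R[n.+1]}) :
  (map_poly (meval (v \o lift ord0)) (first_var_poly p)).[v ord0] = p.@[v].
Proof.
pose g : {rmorphism {mpoly R[n.+1]} -> R} :=
  horner_eval (v ord0) \o map_poly (meval (v \o lift ord0)) \o first_var_poly.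
apply: (@mpoly_rmorph_eq _ _ _ g (meval v)) => [c|i]; rewrite /= /horner_eval.
  by rewrite first_var_polyC map_polyC hornerC /= !mevalC.
case: (unliftP ord0 i) => [j|] ->.
  by rewrite first_var_polyXS map_polyC hornerC /= !mevalXU.
by rewrite first_var_polyX0 map_polyX hornerX mevalXU.
Qed.

End FirstVariable.

(** Specializing all variables but the first leaves a polynomial in one variable that has every
    element of [k] as a root, hence is zero since [k] is algebraically closed. So each coefficient
    vanishes at all points, and induction applies. *)
Lemma mpoly_vanish_eq0 (k : closedFieldType) (n : nat) (p : {mpoly k[n]}) :
  (forall v : 'I_n -> k, p.@[v] = 0) -> p = 0.
Proof.
elim: n p => [p p0|n IHn p p0].
  have -> : p = p.@[fun=> 0]%:MP.
    pose g : {rmorphism {mpoly k[0]} -> {mpoly k[0]}} :=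
      @mpolyC 0 k \o meval (fun=> 0).
    apply/esym; apply: (@mpoly_rmorph_eq _ _ _ g idfun) => [c|[]//].
    by rewrite /= mevalC.
  by rewrite p0.
apply: first_var_poly_inj; rewrite rmorph0; apply/polyP => i; rewrite coef0.
apply: IHn => v; rewrite -[LHS]coef_map.
have [->|/closed_nonrootP[t]] := eqVneq (map_poly (meval v) (first_var_poly p)) 0.
  by rewrite coef0.
pose w i := if unlift ord0 i is Some j then v j else t.
have wE : meval v =1 meval (w \o lift ord0).
  by move=> q; apply: meval_eq => j; rewrite /= /w liftK.
(* The nonroot [t] is displayed as [w ord0], so that the specialized polynomial at [t] becomes the
   value of [p] at [w]. *)
rewrite /root (eq_map_poly wE) -[t]/(if None is Some j then v j else t).
by rewrite -(unlift_none (@ord0 n)) -[X in _.[X]]/(w ord0) first_var_poly_eval p0 eqxx.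
Qed.

(** * Function fields *)

(** The substitution used in [function_field], named so that it can carry a ring morphism
    structure. *)
Definition gen_eval (k : fieldType) (n : nat) (K : kfield k) (a : n.-tuple K) :
  {mpoly k[n]} -> K := mmap (@kf_const k K) (tnth a).

HB.instance Definition _ k n (K : kfield k) (a : n.-tuple K) :=
  GRing.RMorphism.on (gen_eval a).

Section GenEval.
Variables (k : fieldType) (n : nat) (K : kfield k) (a : n.-tuple K).

Lemma gen_evalC c : gen_eval a c%:MP = c%:K.
Proof. exact: mmapC. Qed.

Lemma gen_evalX i : gen_eval a 'X_i = tnth a i.
Proof. exact: mmapXU. Qed.

End GenEval.

Lemma kf_const_eq0 (k : fieldType) (K : kfield k) (c : k) :
  (c%:K == 0 :> K) = (c == 0).
Proof. exact: fmorph_eq0. Qed.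

Section FunctionField.
Variables (k : closedFieldType) (n : nat) (X : n.-tuple k -> Prop).
Variables (K : kfield k) (a : n.-tuple K).
Hypothesis HK : function_field X a.

Lemma gen_eval_eq0P P :
  gen_eval a P = 0 <-> forall x : n.-tuple k, X x -> P.@[tnth x] = 0.
Proof. exact: HK.1. Qed.

Lemma function_fieldP f :
  exists PQ : {mpoly k[n]} * {mpoly k[n]},
    (gen_eval a PQ.2 != 0) && (f == gen_eval a PQ.1 / gen_eval a PQ.2).
Proof. by have [P [Q [Q0 ->]]] := HK.2 f; exists (P, Q); apply/andP. Qed.

Definition num_den f := xchoose (function_fieldP f).

Lemma den_neq0 f : gen_eval a (num_den f).2 != 0.
Proof. by have /andP[] := xchooseP (function_fieldP f). Qed.

Lemma num_denE f :
  f = gen_eval a (num_den f).1 / gen_eval a (num_den f).2.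
Proof. by have /andP[_ /eqP] := xchooseP (function_fieldP f). Qed.

Lemma num_den_mul f :
  f * gen_eval a (num_den f).2 = gen_eval a (num_den f).1.
Proof. by rewrite {1}[f]num_denE divfK ?den_neq0. Qed.

(** * Extension of maps from the generators *)

Section Extension.
Variables (M : kfield k) (b : n.-tuple M).
Hypothesis ab : forall P, gen_eval a P = 0 <-> gen_eval b P = 0.

Definition ext_fun f := gen_eval b (num_den f).1 / gen_eval b (num_den f).2.

Lemma gen_eval_neq0 P : gen_eval a P != 0 -> gen_eval b P != 0.
Proof. by apply: contraNneq => /ab ->. Qed.

(** Two fractions for [f] differ by a polynomial relation among the [a], which by [ab] also holds
    among the [b]. So any fraction computes [ext_fun], not only the chosen one. *)
Lemma ext_funE f P Q :
    gen_eval a Q != 0 -> f * gen_eval a Q = gen_eval a P ->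
  ext_fun f = gen_eval b P / gen_eval b Q.
Proof.
move=> Q0 fQ; apply/eqP.
rewrite eqr_div ?gen_eval_neq0 ?den_neq0 // -!rmorphM -subr_eq0 -rmorphB.
apply/eqP/ab; rewrite rmorphB !rmorphM /= -fQ -num_den_mul.
by ring.
Qed.

Lemma ext_fun_zmod : zmod_morphism ext_fun.
Proof.
move=> f g; have [Qf Qg] := (den_neq0 f, den_neq0 g).
rewrite (@ext_funE _ ((num_den f).1 * (num_den g).2
    - (num_den g).1 * (num_den f).2) ((num_den f).2 * (num_den g).2)).
- rewrite rmorphB !rmorphM /= -mulNr -addf_div ?gen_eval_neq0 //.
  by rewrite mulNr.
- by rewrite rmorphM mulf_neq0.
- rewrite rmorphB !rmorphM /= -!num_den_mul; ring.
Qed.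

Lemma ext_fun_monoid : monoid_morphism ext_fun.
Proof.
split=> [|f g].
  rewrite (@ext_funE _ 1 1) ?rmorph1 ?divr1 ?oner_neq0 //.
  by rewrite mulr1.
have [Qf Qg] := (den_neq0 f, den_neq0 g).
rewrite (@ext_funE _ ((num_den f).1 * (num_den g).1)
  ((num_den f).2 * (num_den g).2)).
- by rewrite !rmorphM /= mulf_div.
- by rewrite rmorphM mulf_neq0.
- rewrite !rmorphM /= -!num_den_mul; ring.
Qed.

(** The source of both field morphisms built below: the action of order three on [K] and the
    embedding of [L] into [K]. *)
Lemma function_field_ext :
  exists phi : kmorph K M, forall i, phi (tnth a i) = tnth b i.
Proof.
pose phiZ := GRing.isZmodMorphism.Build K M ext_fun ext_fun_zmod.
pose phiM := GRing.isMonoidMorphism.Build K M ext_fun ext_fun_monoid.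
pose phi : {rmorphism K -> M} := HB.pack ext_fun phiZ phiM.
have phiE P : phi (gen_eval a P) = gen_eval b P.
  rewrite /= (@ext_funE _ P 1) ?rmorph1 ?oner_neq0 ?divr1 //.
  by rewrite mulr1.
have phiC c : phi c%:K = c%:K by rewrite -(gen_evalC a) phiE gen_evalC.
by exists (KMorph phiC) => i; rewrite -(gen_evalX a) -(gen_evalX b); apply: phiE.
Qed.

End Extension.

(* f is regular at the point x, with value c. *)
Definition has_value (x : n.-tuple k) (f : K) (c : k) : Prop :=
  exists P Q : {mpoly k[n]}, [/\ Q.@[tnth x] != 0,
    f * gen_eval a Q = gen_eval a P & c * Q.@[tnth x] = P.@[tnth x]].

Section Value.
Variable x : n.-tuple k.
Hypothesis Xx : X x.

Lemma has_value_const c : has_value x c%:K c.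
Proof.
exists c%:MP, 1; rewrite !rmorph1 mevalC oner_neq0 !mulr1.
by rewrite gen_evalC.
Qed.

Lemma has_value_coord i : has_value x (tnth a i) (tnth x i).
Proof.
exists 'X_i, 1; rewrite !rmorph1 mevalXU oner_neq0 !mulr1.
by rewrite gen_evalX.
Qed.

Lemma has_valueD f g c d :
  has_value x f c -> has_value x g d -> has_value x (f + g) (c + d).
Proof.
move=> [P [Q [Q0 fQ cQ]]] [P' [Q' [Q'0 gQ' dQ']]].
exists (P * Q' + P' * Q), (Q * Q').
rewrite !rmorphD !rmorphM /= mulf_neq0 // -fQ -gQ' -cQ -dQ'.
by split=> //; ring.
Qed.

Lemma has_valueM f g c d :
  has_value x f c -> has_value x g d -> has_value x (f * g) (c * d).
Proof.
move=> [P [Q [Q0 fQ cQ]]] [P' [Q' [Q'0 gQ' dQ']]].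
exists (P * P'), (Q * Q').
rewrite !rmorphM /= mulf_neq0 // -fQ -gQ' -cQ -dQ'.
by split=> //; ring.
Qed.

(** Here [x] has to lie on [X]: a numerator that vanishes in [K] vanishes at the points of [X]. *)
Lemma has_value0 c : has_value x 0 c -> c = 0.
Proof.
move=> [P [Q [Q0]]]; rewrite mul0r => /esym/gen_eval_eq0P/(_ x Xx) -> /eqP.
by rewrite mulf_eq0 (negbTE Q0) orbF => /eqP.
Qed.

Lemma has_value_neq0 f c : has_value x f c -> c != 0 -> f != 0.
Proof.
by move=> fc; apply: contraNneq => f0; rewrite f0 in fc; rewrite (has_value0 fc).
Qed.

Lemma has_valueV f c : has_value x f c -> c != 0 -> has_value x f^-1 c^-1.
Proof.
move=> fc c0; have f0 := has_value_neq0 fc c0.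
have [P [Q [Q0 fQ cQ]]] := fc.
exists Q, P; rewrite -cQ -fQ mulf_neq0 //.
by split=> //; rewrite mulKf.
Qed.

Lemma has_value_nat m : has_value x m%:R m%:R.
Proof. by rewrite -(rmorph_nat (@kf_const k K)); apply: has_value_const. Qed.

Lemma has_valueB f g c d :
  has_value x f c -> has_value x g d -> has_value x (f - g) (c - d).
Proof.
move=> fc gd; rewrite -mulN1r -[- d]mulN1r; apply: has_valueD => //.
apply: has_valueM => //; rewrite -(rmorph1 (@kf_const k K)) -rmorphN.
exact: has_value_const.
Qed.

Lemma has_valueX f c m : has_value x f c -> has_value x (f ^+ m) (c ^+ m).
Proof.
move=> fc; elim: m => [|m IHm]; first exact: (has_value_nat 1).
by rewrite !exprS; apply: has_valueM.
Qed.

Lemma has_value_div f g c d :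
    has_value x f c -> has_value x g d -> d != 0 ->
  has_value x (f / g) (c / d).
Proof. by move=> fc gd d0; apply: has_valueM => //; apply: has_valueV. Qed.

Lemma has_value_gen_eval (m : nat) (b : m.-tuple K) (y : 'I_m -> k)
    (P : {mpoly k[m]}) :
  (forall i, has_value x (tnth b i) (y i)) -> has_value x (gen_eval b P) P.@[y].
Proof.
move=> by_; elim/mpoly_ring_ind: P => [c|i|P Q IHP IHQ|P Q IHP IHQ].
- by rewrite gen_evalC mevalC; apply: has_value_const.
- by rewrite gen_evalX mevalXU.
- by rewrite rmorphD mevalD; apply: has_valueD.
- by rewrite rmorphM mevalM; apply: has_valueM.
Qed.

End Value.

Lemma gen_eval_kmorph (M : kfield k) (f : {rmorphism K -> M}) :
    (forall c : k, f c%:K = c%:K) ->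
  forall P, f (gen_eval a P) = gen_eval (map_tuple f a) P.
Proof.
move=> fC; elim/mpoly_ring_ind=> [c|i|P Q IHP IHQ|P Q IHP IHQ].
- by rewrite !gen_evalC.
- by rewrite !gen_evalX tnth_map.
- by rewrite !rmorphD /= IHP IHQ.
- by rewrite !rmorphM /= IHP IHQ.
Qed.

Lemma kmorph_eq (M : kfield k) (f g : {rmorphism K -> M}) :
    (forall c : k, f c%:K = c%:K) -> (forall c : k, g c%:K = c%:K) ->
    (forall i, f (tnth a i) = g (tnth a i)) ->
  f =1 g.
Proof.
move=> fC gC fg h; rewrite [h]num_denE !fmorph_div !gen_eval_kmorph //.
have -> // : map_tuple f a = map_tuple g a.
by apply: eq_from_tnth => i; rewrite !tnth_map.
Qed.

(** The map [delta] kills all polynomials in the generators, and the product rule applied to a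
    fraction [f * Q = P] leaves [phi Q * delta f = 0]. For [phi] the identity this gives uniqueness
    of derivations; for [phi] from [L] to [K] it gives the chain rule. *)
Lemma derivation_along_eq0 (M : fieldType) (phi : {rmorphism K -> M})
    (delta : K -> M) :
    (forall f g, delta (f + g) = delta f + delta g) ->
    (forall f g, delta (f * g) = phi f * delta g + phi g * delta f) ->
    (forall c : k, delta c%:K = 0) -> (forall i, delta (tnth a i) = 0) ->
  forall f, delta f = 0.
Proof.
move=> dD dM dC da f.
have dP P : delta (gen_eval a P) = 0.
  elim/mpoly_ring_ind: P => [c|i|P Q IHP IHQ|P Q IHP IHQ].
  - by rewrite gen_evalC dC.
  - by rewrite gen_evalX.
  - by rewrite rmorphD dD IHP IHQ addr0.
  - by rewrite rmorphM dM IHP IHQ !mulr0 addr0.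
have /(congr1 delta) := num_den_mul f.
rewrite dM !dP mulr0 add0r => /eqP.
by rewrite mulf_eq0 fmorph_eq0 (negbTE (den_neq0 f)) => /eqP.
Qed.

Lemma derivation_eq (D D' : derivation K) :
  (forall i, D (tnth a i) = D' (tnth a i)) -> D =1 D'.
Proof.
move=> DD' f; apply/eqP; rewrite -subr_eq0; apply/eqP; move: f.
apply: (@derivation_along_eq0 _ idfun) => [f g|f g|c|i] /=.
- by rewrite !derD; ring.
- by rewrite !derM; ring.
- by rewrite !der_const subrr.
- by rewrite DD' subrr.
Qed.

(** * Partial derivatives with respect to independent generators *)

Section Partial.
Hypothesis a_free : forall P, gen_eval a P = 0 -> P = 0.
Variable i : 'I_n.

Definition partial_fun f :=
  let: (P, Q) := num_den f in
  (gen_eval a P^`M(i) * gen_eval a Q - gen_eval a P * gen_eval a Q^`M(i))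
    / gen_eval a Q ^+ 2.

(** As the generators are independent, the equality of two fractions is an identity
    [P * Q' = P' * Q] of polynomials, which may be differentiated. Hence the quotient rule does not
    depend on the fraction. *)
Lemma partial_funE f P Q :
    gen_eval a Q != 0 -> f * gen_eval a Q = gen_eval a P ->
  partial_fun f = (gen_eval a P^`M(i) - f * gen_eval a Q^`M(i)) / gen_eval a Q.
Proof.
move=> Q0 fQ; have := den_neq0 f; have := num_den_mul f.
rewrite /partial_fun; case: (num_den f) => P' Q' /= fQ' Q'0.
have : P * Q' = P' * Q.
  apply/eqP; rewrite -subr_eq0; apply/eqP/a_free.
  by rewrite rmorphB !rmorphM /= -fQ -fQ'; ring.
move=> /(congr1 (fun R => gen_eval a R^`M(i))).
rewrite !mderivM !rmorphD !rmorphM /= -fQ -fQ' => eqd.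
have {}eqd : gen_eval a P^`M(i) * gen_eval a Q' =
  gen_eval a P'^`M(i) * gen_eval a Q + f * gen_eval a Q' * gen_eval a Q^`M(i)
  - f * gen_eval a Q * gen_eval a Q'^`M(i) by rewrite -eqd addrK.
apply: (mulIf (mulf_neq0 Q0 (expf_neq0 2 Q'0))).
rewrite mulrCA mulfVK ?expf_neq0 // mulrA mulrAC divfK //.
rewrite mulrBl exprS expr1 !mulrA eqd; ring.
Qed.

Lemma partial_exists :
  exists D : derivation K, forall j, D (tnth a j) = (i == j)%:R.
Proof.
have DE P : partial_fun (gen_eval a P) = gen_eval a P^`M(i).
  rewrite (@partial_funE _ P 1) ?rmorph1 ?oner_neq0 ?mulr1 //.
  by rewrite -mpolyC1 mderivC raddf0 mulr0 subr0 divr1.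
have DD f g : partial_fun (f + g) = partial_fun f + partial_fun g.
  have [[Qf Qg] [Pf Pg]] := ((den_neq0 f, den_neq0 g), (num_den_mul f, num_den_mul g)).
  rewrite (partial_funE Qf Pf) (partial_funE Qg Pg).
  rewrite (@partial_funE _ ((num_den f).1 * (num_den g).2
    + (num_den g).1 * (num_den f).2) ((num_den f).2 * (num_den g).2)).
  - rewrite mderivD !mderivM !rmorphD !rmorphM /= -Pf -Pg; field.
    by rewrite Qf Qg.
  - by rewrite rmorphM mulf_neq0.
  - by rewrite rmorphD !rmorphM /= -Pf -Pg; ring.
have DM f g : partial_fun (f * g) = f * partial_fun g + g * partial_fun f.
  have [[Qf Qg] [Pf Pg]] := ((den_neq0 f, den_neq0 g), (num_den_mul f, num_den_mul g)).
  rewrite (partial_funE Qf Pf) (partial_funE Qg Pg).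
  rewrite (@partial_funE _ ((num_den f).1 * (num_den g).1)
    ((num_den f).2 * (num_den g).2)).
  - rewrite !mderivM !rmorphD !rmorphM /= -Pf -Pg; field.
    by rewrite Qf Qg.
  - by rewrite rmorphM mulf_neq0.
  - by rewrite !rmorphM /= -Pf -Pg; ring.
have DC c : partial_fun c%:K = 0.
  by rewrite -(gen_evalC a) DE mderivC raddf0.
exists (Derivation DD DM DC) => j /=; rewrite -(gen_evalX a) DE mderivX mnm1E eq_sym.
case: eqP => [->|_]; last by rewrite scale0r raddf0.
have -> : (U_(j) - U_(j) = 0)%MM by apply/mnmP=> l; rewrite mnmBE subnn mnm0E.
by rewrite scale1r mpolyX0 rmorph1.
Qed.

End Partial.

End FunctionField.

Lemma affine_free (k : closedFieldType) (n : nat) (K : kfield k) (a : n.-tuple K) :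
    function_field (fun=> True) a ->
  forall P, gen_eval a P = 0 -> P = 0.
Proof.
move=> HK P /(gen_eval_eq0P HK) P0; apply: mpoly_vanish_eq0 => y.
by rewrite -(P0 [tuple y i | i < n]) //; apply: meval_eq => i; rewrite tnth_mktuple.
Qed.

(** * Cyclic cubic extensions *)

Lemma cube_root_of_unity (R : comNzRingType) (w : R) :
  1 + w + w ^+ 2 = 0 -> w ^+ 3 = 1.
Proof.
move=> w0; apply/eqP; rewrite -subr_eq0; apply/eqP.
by transitivity ((w - 1) * (1 + w + w ^+ 2)); [ring | rewrite w0 mulr0].
Qed.

Lemma kf_const_root (k : fieldType) (K : kfield k) (w : k) :
  1 + w + w ^+ 2 = 0 -> w%:K ^+ 2 = - 1 - w%:K :> K.
Proof.
move=> w0; rewrite -rmorphXn -(rmorph1 (@kf_const k K)) -rmorphN -rmorphB.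
by congr _%:K; apply/eqP; rewrite -subr_eq0 -w0; apply/eqP; ring.
Qed.

Section CyclicCubic.
Variables (k : fieldType) (K M : kfield k) (sigma : kmorph K K).
Variables (phi : kmorph M K) (w : k) (xi : K) (c : M).
Hypothesis three_neq0 : 3%:R != 0 :> k.
Hypothesis w_root : 1 + w + w ^+ 2 = 0.
Hypothesis sigma_phi : forall m, sigma (phi m) = phi m.
Hypothesis sigma_xi : sigma xi = (w ^+ 2)%:K * xi.
Hypothesis xi_neq0 : xi != 0.
Hypothesis xi_cubed : xi ^+ 3 = phi c.

Local Notation W := (w%:K : K).

Let three_neq0K : 3%:R != 0 :> K.
Proof. by rewrite -(rmorph_nat (@kf_const k K)) kf_const_eq0. Qed.

Let W2 : W ^+ 2 = - 1 - W.
Proof. exact: kf_const_root. Qed.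

Let sxi : sigma xi = (- 1 - W) * xi.
Proof. by rewrite sigma_xi rmorphXn /= W2. Qed.

Let sW : sigma W = W.
Proof. exact: kmorph_const. Qed.

Let simp := (rmorphD, rmorphB, rmorphN, rmorphM, rmorphXn, rmorph1, rmorph_nat).

(** The terms are eigenvectors of [sigma] for the eigenvalues [1], [w ^+ 2] and [w]. Below, [w ^+ 2]
    is written [- 1 - W], the normal form for [ring: W2]. *)
Definition kummer_sum (m0 m1 m2 : M) : K :=
  phi m0 + phi m1 * xi + phi m2 * xi ^+ 2.

Lemma kummer_sum_sigma m0 m1 m2 : sigma (kummer_sum m0 m1 m2) =
  phi m0 + (- 1 - W) * (phi m1 * xi) + W * (phi m2 * xi ^+ 2).
Proof.
rewrite /kummer_sum !simp !sigma_phi sxi /=; ring: W2.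
Qed.

Lemma kummer_sum_sigma2 m0 m1 m2 : sigma (sigma (kummer_sum m0 m1 m2)) =
  phi m0 + W * (phi m1 * xi) + (- 1 - W) * (phi m2 * xi ^+ 2).
Proof.
rewrite kummer_sum_sigma !simp !sigma_phi sxi sW /=; ring: W2.
Qed.

(** Independence of [1], [xi], [xi ^+ 2]: each term times 3 is a combination of the three conjugates
    with cube roots of unity as coefficients, by Fourier inversion for the group of order three. *)
Lemma kummer_sum_inj m0 m1 m2 n0 n1 n2 :
    kummer_sum m0 m1 m2 = kummer_sum n0 n1 n2 ->
  [/\ m0 = n0, m1 = n1 & m2 = n2].
Proof.
move=> eq0; have eq1 := congr1 sigma eq0; have eq2 := congr1 sigma eq1.
rewrite !kummer_sum_sigma2 in eq2; rewrite !kummer_sum_sigma in eq1.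
rewrite /kummer_sum in eq0.
have x2 : xi ^+ 2 != 0 by rewrite expf_neq0.
split; apply: (fmorph_inj phi); apply: (mulIf three_neq0K).
- transitivity ((phi m0 + phi m1 * xi + phi m2 * xi ^+ 2)
    + (phi m0 + (- 1 - W) * (phi m1 * xi) + W * (phi m2 * xi ^+ 2))
    + (phi m0 + W * (phi m1 * xi) + (- 1 - W) * (phi m2 * xi ^+ 2))).
    by ring.
  by rewrite eq0 eq1 eq2; ring.
- apply: (mulIf xi_neq0).
  transitivity ((phi m0 + phi m1 * xi + phi m2 * xi ^+ 2)
    + W * (phi m0 + (- 1 - W) * (phi m1 * xi) + W * (phi m2 * xi ^+ 2))
    + (- 1 - W) * (phi m0 + W * (phi m1 * xi) + (- 1 - W) * (phi m2 * xi ^+ 2))).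
    by ring: W2.
  by rewrite eq0 eq1 eq2; ring: W2.
- apply: (mulIf x2).
  transitivity ((phi m0 + phi m1 * xi + phi m2 * xi ^+ 2)
    + (- 1 - W) * (phi m0 + (- 1 - W) * (phi m1 * xi) + W * (phi m2 * xi ^+ 2))
    + W * (phi m0 + W * (phi m1 * xi) + (- 1 - W) * (phi m2 * xi ^+ 2))).
    by ring: W2.
  by rewrite eq0 eq1 eq2; ring: W2.
Qed.

Lemma kummer_sumD m0 m1 m2 n0 n1 n2 :
  kummer_sum m0 m1 m2 + kummer_sum n0 n1 n2 =
  kummer_sum (m0 + n0) (m1 + n1) (m2 + n2).
Proof. by rewrite /kummer_sum !rmorphD; ring. Qed.

Lemma kummer_sumM m0 m1 m2 n0 n1 n2 :
  kummer_sum m0 m1 m2 * kummer_sum n0 n1 n2 =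
  kummer_sum (m0 * n0 + c * (m1 * n2 + m2 * n1))
             (m0 * n1 + m1 * n0 + c * (m2 * n2))
             (m0 * n2 + m1 * n1 + m2 * n0).
Proof. by rewrite /kummer_sum !simp -xi_cubed; ring. Qed.

(** The norm form of a cubic radical extension. That the product of the conjugates lies in the image
    of [phi] serves to clear denominators. *)
Lemma kummer_norm m0 m1 m2 (f := kummer_sum m0 m1 m2) :
  f * sigma f * sigma (sigma f) =
  phi (m0 ^+ 3 + c * m1 ^+ 3 + c ^+ 2 * m2 ^+ 3 - 3%:R * (c * m0 * m1 * m2)).
Proof.
rewrite /f kummer_sum_sigma2 kummer_sum_sigma /kummer_sum !simp -xi_cubed.
ring: W2.
Qed.

Lemma kummer_sum_phi m : kummer_sum m 0 0 = phi m.
Proof. by rewrite /kummer_sum rmorph0 !mul0r !addr0. Qed.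

Section Generation.
Hypothesis kummer_gen : forall f, exists m : M * M * M,
  f == kummer_sum m.1.1 m.1.2 m.2.

(** Summing the conjugates cancels the components on [xi] and [xi ^+ 2], so [3 * f = 3 * phi m0] for
    an invariant [f]. *)
Lemma invariant_in_image f : sigma f = f -> exists m, phi m = f.
Proof.
have [[[m0 m1] m2] /eqP ->] := kummer_gen f => /= sf; exists m0.
have s2f := etrans (congr1 sigma sf) sf; rewrite kummer_sum_sigma2 in s2f.
rewrite kummer_sum_sigma in sf; apply: (mulIf three_neq0K).
transitivity (phi m0 + phi m1 * xi + phi m2 * xi ^+ 2
    + (phi m0 + (- 1 - W) * (phi m1 * xi) + W * (phi m2 * xi ^+ 2))
    + (phi m0 + W * (phi m1 * xi) + (- 1 - W) * (phi m2 * xi ^+ 2))).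
  by ring.
by rewrite sf s2f /kummer_sum; ring.
Qed.

Variable D : derivation M.

(* Differentiating xi ^+ 3 = phi c forces D' xi = phi (D c) / (3 phi c) * xi. *)
Definition kummer_der (m0 m1 m2 : M) : K :=
  kummer_sum (D m0) (D m1) (D m2) +
  phi (D c) / (3%:R * phi c) * (phi m1 * xi + 2%:R * (phi m2 * xi ^+ 2)).

(** By uniqueness of the expansion, [kummer_der] defines a function on [K]; the value it gives to
    [xi] is compatible with the reduction of [xi ^+ 3] to [phi c], whence the product rule. *)
Lemma derivation_ext : exists D' : derivation K, forall m, D' (phi m) = phi (D m).
Proof.
pose m f := xchoose (kummer_gen f).
have mE f : f = kummer_sum (m f).1.1 (m f).1.2 (m f).2.
  exact: eqP (xchooseP (kummer_gen f)).
pose D' f := kummer_der (m f).1.1 (m f).1.2 (m f).2.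
have D'E m0 m1 m2 : D' (kummer_sum m0 m1 m2) = kummer_der m0 m1 m2.
  by rewrite /D'; have /kummer_sum_inj[<- <- <-] := mE (kummer_sum m0 m1 m2).
have c0 : phi c != 0 by rewrite -xi_cubed expf_neq0.
have DD f g : D' (f + g) = D' f + D' g.
  rewrite [f]mE [g]mE kummer_sumD !D'E /kummer_der /kummer_sum !derD !rmorphD.
  by ring.
have DM f g : D' (f * g) = f * D' g + g * D' f.
  rewrite [f]mE [g]mE kummer_sumM !D'E; move: (m f) (m g).
  move=> [[m0 m1] m2] [[n0 n1] n2] /=.
  (* [h] is the logarithmic derivative of [xi]; eliminating [phi (D c)] in its favour leaves an
     identity of polynomials. *)
  set h := phi (D c) / (3%:R * phi c).
  have hE : phi (D c) = 3%:R * xi ^+ 3 * h.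
    by rewrite /h xi_cubed mulrC divfK // mulf_neq0.
  rewrite /kummer_der /kummer_sum -/h !derD !derM !simp !derD !derM !simp hE.
  by rewrite -xi_cubed; ring.
have D_phi x : D' (phi x) = phi (D x).
  have D0 : D 0 = 0 by have := der_const D 0; rewrite rmorph0.
  by rewrite -kummer_sum_phi D'E /kummer_der D0 kummer_sum_phi rmorph0; ring.
have DC a : D' a%:K = 0.
  by rewrite -(kmorph_const phi) D_phi der_const rmorph0.
by exists (Derivation DD DM DC).
Qed.

End Generation.

End CyclicCubic.

(** The Kummer sums form a ring that is stable under [sigma] and contains the generators. A quotient
    is expanded by the conjugates of its denominator [Q], which turns [Q] into a norm, inverted in
    [M]. *)
Lemma function_field_kummer_gen (k : closedFieldType) (n : nat)
    (X : n.-tuple k -> Prop) (K M : kfield k) (a : n.-tuple K)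
    (sigma : kmorph K K) (phi : kmorph M K) (w : k) (xi : K) (c : M) :
    function_field X a -> 1 + w + w ^+ 2 = 0 ->
    (forall m, sigma (phi m) = phi m) -> sigma xi = (w ^+ 2)%:K * xi ->
    xi ^+ 3 = phi c ->
    (forall i, exists m : M * M * M,
      tnth a i = kummer_sum phi xi m.1.1 m.1.2 m.2) ->
  forall f, exists m : M * M * M, f == kummer_sum phi xi m.1.1 m.1.2 m.2.
Proof.
move=> HK w0 sphi sxi xic agen.
pose gen f := exists m : M * M * M, f = kummer_sum phi xi m.1.1 m.1.2 m.2.
have genM f g : gen f -> gen g -> gen (f * g).
  by case=> m -> [m' ->]; rewrite (kummer_sumM xic); eexists (_, _, _).
have gen_sigma f : gen f -> gen (sigma f).
  case=> -[[m0 m1] m2] -> /=; rewrite (kummer_sum_sigma w0 sphi sxi).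
  exists (m0, (- 1 - w%:K) * m1, w%:K * m2); rewrite /kummer_sum /=.
  by rewrite !(rmorphM, rmorphB, rmorphN, rmorph1) /= !kmorph_const; ring.
have gen_phi m : gen (phi m) by exists (m, 0, 0); rewrite /= kummer_sum_phi.
have geneval P : gen (gen_eval a P).
  elim/mpoly_ring_ind: P => [b|i|P Q [m Pm] [m' Qm']|P Q IHP IHQ].
  - by rewrite gen_evalC -(kmorph_const phi).
  - by rewrite gen_evalX.
  - by rewrite rmorphD /= Pm Qm' kummer_sumD; eexists (_, _, _).
  - by rewrite rmorphM; apply: genM.
move=> f; suff [m ->] : gen f by exists m.
rewrite (num_denE HK f); set P := gen_eval _ _; set Q := gen_eval _ _.
have Q0 : Q != 0 := den_neq0 HK f.
have [m mE] : exists m, phi m = Q * sigma Q * sigma (sigma Q).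
  have [[[m0 m1] m2] QE] := geneval (num_den HK f).2; rewrite /Q QE.
  by rewrite (kummer_norm w0 sphi sxi xic); eexists.
have -> : P / Q = P * (sigma Q * sigma (sigma Q)) * phi m^-1.
  by rewrite fmorphV mE; field; rewrite !fmorph_eq0 Q0.
apply: (genM); last exact: gen_phi.
have genQ : gen Q := geneval _.
by apply: (genM); [exact: geneval | apply: (genM); do !apply: (gen_sigma)].
Qed.

(** * The plane model of the quotient *)

Section DerivationCalculus.
Variables (k : fieldType) (K : kfield k) (D : derivation K).

Lemma der0 : D 0 = 0.
Proof. by have := der_const D 0; rewrite rmorph0. Qed.

Lemma der1 : D 1 = 0.
Proof. by have := der_const D 1; rewrite rmorph1. Qed.

Lemma der_nat m : D m%:R = 0.
Proof. by have := der_const D m%:R; rewrite rmorph_nat. Qed.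

Lemma derN f : D (- f) = - D f.
Proof. by apply/eqP; rewrite -addr_eq0 -derD addNr der0. Qed.

Lemma derB f g : D (f - g) = D f - D g.
Proof. by rewrite derD derN. Qed.

Lemma derX f m : D (f ^+ m) = m%:R * f ^+ m.-1 * D f.
Proof.
elim: m => [|m IHm]; first by rewrite expr0 der1 !mul0r.
rewrite exprS derM IHm; case: m {IHm} => [|m] /=; first by ring.
by rewrite !exprS -[m.+2%:R]natr1; ring.
Qed.

Lemma der_div f g : g != 0 -> D (f / g) = (D f * g - f * D g) / g ^+ 2.
Proof.
move=> g0; have /(congr1 D) := divfK g0 f.
by rewrite derM => <-; field.
Qed.

End DerivationCalculus.

Lemma der_lin_comb (k : fieldType) (K : kfield k) (h1 h2 : K)
    (D1 D2 : derivation K) :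
  exists D : derivation K, forall f, D f = h1 * D1 f + h2 * D2 f.
Proof.
have DD f g : h1 * D1 (f + g) + h2 * D2 (f + g) =
  h1 * D1 f + h2 * D2 f + (h1 * D1 g + h2 * D2 g) by rewrite !derD; ring.
have DM f g : h1 * D1 (f * g) + h2 * D2 (f * g) =
    f * (h1 * D1 g + h2 * D2 g) + g * (h1 * D1 f + h2 * D2 f).
  by rewrite !derM; ring.
have DC c : h1 * D1 c%:K + h2 * D2 c%:K = 0 by rewrite !der_const !mulr0 addr0.
by exists (Derivation DD DM DC).
Qed.

(** The cubics S and T dehomogenized at [z = 1]. *)
Definition cubicS (R : comNzRingType) (u v : R) := u ^+ 2 * v + v ^+ 2 + u.
Definition cubicT (R : comNzRingType) (u v : R) := u * v ^+ 2 + v + u ^+ 2.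

Section PlaneModel.
Variables (F : fieldType) (th : F).
Hypothesis two_neq0 : 2%:R != 0 :> F.
Hypothesis th2 : th ^+ 2 = - 3%:R.
Hypothesis th_neq0 : th != 0.

(** [th] stands for [1 + 2 w], a square root of -3, and [plane_mu] is the function that becomes
    [xi0 / xi1]. *)
Definition plane_zeta0 (u v : F) := (u ^+ 3 + v ^+ 3 - 2%:R) / (u ^+ 3 - v ^+ 3).
Definition plane_zeta1 (u v : F) :=
  th * (cubicT u v + cubicS u v) / (cubicS u v - cubicT u v).
Definition plane_mu (u v : F) := (cubicT u v - cubicS u v) / (u ^+ 3 - v ^+ 3).

(* In the homogeneous coordinates (x : y : z) the cubics S, T and             *)
(* Q3 = x^3 - y^3, Q1 = y^3 - z^3, Q2 = z^3 - x^3 satisfy the syzygies        *)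
(* T x - S y = Q3 z, T y - S z = Q1 x, T z - S x = Q2 y.  They form a linear  *)
(* system in (x : y : z) once S, T, Q1 are known up to scale; normalizing by  *)
(* Q3 = 1 and solving the first two by Cramer's rule gives surf_u and surf_v. *)
Definition surfS (mu zeta1 : F) := - (mu * (zeta1 + th)) / (2%:R * th).
Definition surfT (mu zeta1 : F) := mu * (th - zeta1) / (2%:R * th).
Definition surfQ (zeta0 : F) := (zeta0 - 1) / 2%:R.
Definition surf_den (mu zeta0 zeta1 : F) :=
  surfT mu zeta1 ^+ 2 - surfS mu zeta1 * surfQ zeta0.
Definition surf_u (mu zeta0 zeta1 : F) :=
  (surfT mu zeta1 + surfS mu zeta1 ^+ 2) / surf_den mu zeta0 zeta1.
Definition surf_v (mu zeta0 zeta1 : F) :=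
  (surfT mu zeta1 * surfS mu zeta1 + surfQ zeta0) / surf_den mu zeta0 zeta1.

Lemma cubicTS (u v : F) : cubicT u v ^+ 3 - cubicS u v ^+ 3 =
  (u ^+ 3 - v ^+ 3) * (v ^+ 3 - 1) * (1 - u ^+ 3).
Proof. by rewrite /cubicT /cubicS; ring. Qed.

(** Dividing the equations [zeta ^+ 2 - 1 = 4 xi ^+ 3] of the two factors gives this relation. Since
    [th ^+ 2 = - 3], [zeta1 ^+ 2 - 1] contributes the factor T^2 + T S + S^2, which completes T - S
    to T^3 - S^3. *)
Lemma plane_relation (u v : F) :
    u ^+ 3 - v ^+ 3 != 0 -> cubicT u v - cubicS u v != 0 ->
  plane_mu u v ^+ 3 * (plane_zeta1 u v ^+ 2 - 1) = plane_zeta0 u v ^+ 2 - 1.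
Proof.
move=> uv0 TS0; have ST0 : cubicS u v - cubicT u v != 0 by rewrite -opprB oppr_eq0.
transitivity (- 4%:R * (cubicT u v ^+ 3 - cubicS u v ^+ 3) / (u ^+ 3 - v ^+ 3) ^+ 3).
  by rewrite /plane_mu /plane_zeta1; field: th2; rewrite uv0 ST0.
by rewrite cubicTS /plane_zeta0; field.
Qed.

Section PlaneToSurface.
Variables u v : F.
Hypothesis uv0 : u ^+ 3 - v ^+ 3 != 0.
Hypothesis ST0 : cubicS u v - cubicT u v != 0.
Let z0 := plane_zeta0 u v.
Let z1 := plane_zeta1 u v.
Let mu := plane_mu u v.

Lemma surfS_plane : surfS mu z1 = cubicS u v / (u ^+ 3 - v ^+ 3).
Proof.
rewrite /surfS /mu /z1 /plane_mu /plane_zeta1; field; rewrite th_neq0 two_neq0.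
by rewrite ST0 uv0.
Qed.

Lemma surfT_plane : surfT mu z1 = cubicT u v / (u ^+ 3 - v ^+ 3).
Proof.
rewrite /surfT /mu /z1 /plane_mu /plane_zeta1; field; rewrite th_neq0 two_neq0.
by rewrite ST0 uv0.
Qed.

Lemma surfQ_plane : surfQ z0 = (v ^+ 3 - 1) / (u ^+ 3 - v ^+ 3).
Proof.
by rewrite /surfQ /z0 /plane_zeta0; field; rewrite two_neq0 uv0.
Qed.

Let den := cubicT u v ^+ 2 - cubicS u v * (v ^+ 3 - 1).

Lemma surf_den_plane : surf_den mu z0 z1 = den / (u ^+ 3 - v ^+ 3) ^+ 2.
Proof.
by rewrite /surf_den surfS_plane surfT_plane surfQ_plane /den; field.
Qed.

Hypothesis den0 : den != 0.

(** Once denominators are cleared, this is Cramer's formula for the two syzygies, an identity of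
    polynomials in [u] and [v]. *)
Lemma surf_u_plane : surf_u mu z0 z1 = u.
Proof.
rewrite /surf_u surf_den_plane surfS_plane surfT_plane.
apply: (mulIf den0); rewrite /den; transitivity
  (cubicT u v * (u ^+ 3 - v ^+ 3) + cubicS u v ^+ 2); last first.
  by rewrite /cubicT /cubicS; ring.
by rewrite -/den; field; rewrite den0 uv0.
Qed.

Lemma surf_v_plane : surf_v mu z0 z1 = v.
Proof.
rewrite /surf_v surf_den_plane surfS_plane surfT_plane surfQ_plane.
apply: (mulIf den0); rewrite /den; transitivity
  (cubicT u v * cubicS u v + (v ^+ 3 - 1) * (u ^+ 3 - v ^+ 3)); last first.
  by rewrite /cubicT /cubicS; ring.
by rewrite -/den; field; rewrite den0 uv0.
Qed.

End PlaneToSurface.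

Section SurfaceToPlane.
Variables mu z0 z1 : F.
Hypothesis rel : mu ^+ 3 * (z1 ^+ 2 - 1) = z0 ^+ 2 - 1.
Hypothesis den0 : surf_den mu z0 z1 != 0.
Hypothesis mu0 : mu != 0.
Let u := surf_u mu z0 z1.
Let v := surf_v mu z0 z1.
Let S := surfS mu z1.
Let T := surfT mu z1.
Let Q := surfQ z0.

Let Tu : T * u - S * v = 1.
Proof.
rewrite /u /v /surf_u /surf_v -/S -/T -/Q; move: den0.
by rewrite /surf_den -/S -/T -/Q => d0; field.
Qed.

Let Tv : T * v - S = u * Q.
Proof.
rewrite /u /v /surf_u /surf_v -/S -/T -/Q; move: den0.
by rewrite /surf_den -/S -/T -/Q => d0; field.
Qed.

(** With Q3 = 1 and Q1 + Q2 + Q3 = 0 one has Q2 = - (1 + Q): this is T^3 - S^3 = Q1 Q2 Q3, the form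
    taken by [rel]. *)
Let cubic : T ^+ 3 - S ^+ 3 = - Q * (1 + Q).
Proof.
have four_neq0 : 4%:R != 0 :> F by rewrite (natrM _ 2 2) mulf_neq0.
transitivity (- (mu ^+ 3 * (z1 ^+ 2 - 1)) / 4%:R).
  by rewrite /T /S /surfT /surfS; field: th2; rewrite two_neq0 th_neq0 four_neq0.
by rewrite rel /Q /surfQ; field; rewrite two_neq0 four_neq0.
Qed.

(** The third syzygy. Only the first two define [u] and [v]; the defect of this one is a multiple of
    [cubic]. *)
Let Tw : T - u * S = - v * (1 + Q).
Proof.
have d0 : T ^+ 2 - S * Q != 0 := den0.
apply/eqP; rewrite -subr_eq0; apply/eqP.
transitivity ((T ^+ 3 - S ^+ 3 + Q * (1 + Q)) / (T ^+ 2 - S * Q)).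
  by rewrite /u /v /surf_u /surf_v /surf_den -/S -/T -/Q; field.
by rewrite cubic mulNr addNr mul0r.
Qed.

(** For given [u] and [v] the syzygies are linear in [S], [T], [Q]. Adding [v] times the second and
    [u] times the third eliminates [Q]; together with the first this yields [T] here and [S]
    next. *)
Let uvT : (u ^+ 3 - v ^+ 3) * T = cubicT u v.
Proof.
apply/eqP; rewrite -subr_eq0; apply/eqP; transitivity
  (- v * (v * (T * v - S - u * Q) + u * (T - u * S + v * (1 + Q)))
   + (v + u ^+ 2) * (T * u - S * v - 1)); first by rewrite /cubicT; ring.
by rewrite Tu Tv Tw; ring.
Qed.

Let uvS : (u ^+ 3 - v ^+ 3) * S = cubicS u v.
Proof.
apply/eqP; rewrite -subr_eq0; apply/eqP; transitivity
  (- u * (v * (T * v - S - u * Q) + u * (T - u * S + v * (1 + Q)))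
   + (v ^+ 2 + u) * (T * u - S * v - 1)); first by rewrite /cubicS; ring.
by rewrite Tu Tv Tw; ring.
Qed.

Hypothesis uv0 : u ^+ 3 - v ^+ 3 != 0.

Let uvQ : (u ^+ 3 - v ^+ 3) * Q = v ^+ 3 - 1.
Proof.
(* [Q] has coefficient [u] in the second syzygy and [v] in the third, and [uv0] prevents both from
   vanishing. *)
have [u0|u0] := eqVneq u 0; last first.
  apply: (mulfI u0); rewrite mulrCA -Tv mulrBr mulrA uvT uvS /cubicT /cubicS.
  by ring.
have v0 : v != 0 by apply: contraNneq uv0 => ->; rewrite u0 expr0n subrr.
apply: (mulfI v0); apply/eqP; rewrite -subr_eq0; apply/eqP; transitivity
  (u * ((u ^+ 3 - v ^+ 3) * S) - (u ^+ 3 - v ^+ 3) * T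
   + (u ^+ 3 - v ^+ 3) * (T - u * S + v * (1 + Q)) - v * (u ^+ 3 - 1)); first by ring.
by rewrite Tw uvS uvT /cubicT /cubicS; ring.
Qed.

Lemma plane_zeta0_surf : plane_zeta0 u v = z0.
Proof.
apply: (mulIf uv0); rewrite /plane_zeta0 divfK //.
transitivity (2%:R * (v ^+ 3 - 1) + (u ^+ 3 - v ^+ 3)); first by ring.
by rewrite -uvQ /Q /surfQ; field.
Qed.

Let TS : T - S = mu.
Proof. by rewrite /T /S /surfT /surfS; field; rewrite two_neq0 th_neq0. Qed.

Let cubicTS_mu : cubicT u v - cubicS u v = (u ^+ 3 - v ^+ 3) * mu.
Proof. by rewrite -uvT -uvS -mulrBr TS. Qed.

Lemma plane_mu_surf : plane_mu u v = mu.
Proof. by rewrite /plane_mu cubicTS_mu mulrC mulKf. Qed.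

Lemma plane_zeta1_surf : plane_zeta1 u v = z1.
Proof.
rewrite /plane_zeta1 -opprB cubicTS_mu -uvT -uvS /T /S /surfT /surfS; field.
by rewrite two_neq0 th_neq0 oppr_eq0 mulf_neq0.
Qed.

Lemma cubicST_neq0 : cubicS u v - cubicT u v != 0.
Proof. by rewrite -opprB oppr_eq0 cubicTS_mu mulf_neq0. Qed.

End SurfaceToPlane.
End PlaneModel.

(** * Pull-back of the 1-form to the plane *)

Section PlaneForms.
Variables (k : fieldType) (K : kfield k) (D : derivation K) (th : k) (u v : K).
Hypothesis three_neq0 : 3%:R != 0 :> K.
Hypothesis uv0 : u ^+ 3 - v ^+ 3 != 0.
Hypothesis ST0 : cubicS u v - cubicT u v != 0.

(** On the right stands the form of [foliation_F4] at [z = 1]. The quotient rule makes both sides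
    linear in [D u] and [D v], so this is a comparison of rational functions in [u] and [v]. *)
Lemma plane_form (alpha : k) :
  plane_mu u v ^+ 2 * D (plane_zeta1 th%:K u v)
    - (3%:R^-1 * th * (1 - alpha))%:K * D (plane_zeta0 u v) =
  2%:R * th%:K / (u ^+ 3 - v ^+ 3) ^+ 2 *
    ((v ^+ 3 - 1) * (v - alpha%:K * u ^+ 2) * D u
     + (1 - u ^+ 3) * (u - alpha%:K * v ^+ 2) * D v).
Proof.
rewrite /plane_mu /plane_zeta0 /plane_zeta1 !der_div //.
have := ST0; rewrite /cubicS /cubicT.
rewrite !(derD, derN, derM, derX, der1, der_const).
rewrite !(rmorphM, rmorphB, rmorph1, fmorphV, rmorph_nat) /=.
move: th%:K => t; move: alpha%:K => al ST1.
by field; rewrite uv0 three_neq0 ST1.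
Qed.

End PlaneForms.

(** * The function field of E x E *)

Lemma function_field_on_E (k : closedFieldType) (n : nat) (X : n.-tuple k -> Prop)
    (K : kfield k) (a : n.-tuple K) (i j : 'I_n) :
    function_field X a -> (forall x, X x -> on_E (tnth x i) (tnth x j)) ->
  tnth a j ^+ 2 = 4%:R * tnth a i ^+ 3 + 1.
Proof.
move=> HK XE; pose P : {mpoly k[n]} := 'X_j ^+ 2 - (4%:R * 'X_i ^+ 3 + 1).
have PE : gen_eval a P = tnth a j ^+ 2 - (4%:R * tnth a i ^+ 3 + 1).
  rewrite !(rmorphB, rmorphD, rmorphM, rmorphXn, rmorph_nat, rmorph1) /=.
  by rewrite !gen_evalX.
apply/subr0_eq; rewrite -PE; apply/(gen_eval_eq0P HK) => x /XE xE.
rewrite !(rmorphB, rmorphD, rmorphM, rmorphXn, rmorph_nat, rmorph1) /=.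
by rewrite !mevalXU; apply/eqP; rewrite subr_eq0; apply/eqP.
Qed.

Section Surface.
Variables (k : closedFieldType) (K : kfield k) (xi0 zeta0 xi1 zeta1 : K).
Hypothesis HK : function_field (@ExE_chart k) [tuple xi0; zeta0; xi1; zeta1].
Hypothesis two_neq0 : 2%:R != 0 :> k.
Hypothesis three_neq0 : 3%:R != 0 :> k.
Variable w : k.
Hypothesis w_root : 1 + w + w ^+ 2 = 0.

Local Notation a := [tuple xi0; zeta0; xi1; zeta1].
Local Notation th := (1 + 2%:R * w).
Local Notation thK := (th%:K : K).

Let four_neq0 : 4%:R != 0 :> k.
Proof. by rewrite (natrM _ 2 2) mulf_neq0. Qed.

Let nat_neq0K m : m%:R != 0 :> k -> m%:R != 0 :> K.
Proof. by rewrite -(rmorph_nat (@kf_const k K)) kf_const_eq0. Qed.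

Lemma theta_sqr : th ^+ 2 = - 3%:R.
Proof.
apply/eqP; rewrite -addr_eq0; apply/eqP.
by transitivity (4%:R * (1 + w + w ^+ 2)); [ring | rewrite w_root mulr0].
Qed.

Lemma theta_neq0 : th != 0.
Proof.
apply: contraNneq three_neq0 => th0.
by rewrite -oppr_eq0 -theta_sqr th0 expr0n.
Qed.

Let th2K : thK ^+ 2 = - 3%:R.
Proof. by rewrite -rmorphXn theta_sqr rmorphN rmorph_nat. Qed.

Let thK_neq0 : thK != 0.
Proof. by rewrite kf_const_eq0 theta_neq0. Qed.

Lemma curve_eq0 : zeta0 ^+ 2 = 4%:R * xi0 ^+ 3 + 1.
Proof.
pose i : 'I_4 := Ordinal (isT : 0 < 4)%N; pose j : 'I_4 := Ordinal (isT : 1 < 4)%N.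
have := function_field_on_E HK (i := i) (j := j); rewrite !(tnth_nth 0).
by apply=> x []; rewrite !(tnth_nth 0).
Qed.

Lemma curve_eq1 : zeta1 ^+ 2 = 4%:R * xi1 ^+ 3 + 1.
Proof.
pose i : 'I_4 := Ordinal (isT : 2 < 4)%N; pose j : 'I_4 := Ordinal (isT : 3 < 4)%N.
have := function_field_on_E HK (i := i) (j := j); rewrite !(tnth_nth 0).
by apply=> x []; rewrite !(tnth_nth 0).
Qed.

Definition xi_ratio := xi0 / xi1.
Local Notation mu := xi_ratio.
(** The functions [chart_u] and [chart_v] are the coordinates of the plane pulled back to E x E. *)
Definition chart_u := surf_u thK mu zeta0 zeta1.
Definition chart_v := surf_v thK mu zeta0 zeta1.

(** The first three conditions avoid the nine lines; the last keeps the denominator of the inverse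
    map from vanishing. *)
Definition good_point (y0 y1 : k) :=
  [&& y0 ^+ 3 - y1 ^+ 3 != 0, y0 ^+ 3 - 1 != 0, y1 ^+ 3 - 1 != 0 &
   cubicT y0 y1 ^+ 2 - cubicS y0 y1 * (y1 ^+ 3 - 1) != 0].

(** Every good point is the image of a point of E x E. Nonvanishing in [K] is then proved by
    evaluation at such a point. *)
Lemma good_point_lift (y0 y1 : k) : good_point y0 y1 ->
  exists x, [/\ ExE_chart x, has_value a x chart_u y0, has_value a x chart_v y1 &
    [/\ xi0 != 0, xi1 != 0 & surf_den thK mu zeta0 zeta1 != 0]].
Proof.
case/and4P=> y01 y0_1 y1_1 den0.
pose z0 := plane_zeta0 y0 y1; pose z1 := plane_zeta1 th y0 y1.
pose m := plane_mu y0 y1.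
have TS3 : cubicT y0 y1 ^+ 3 - cubicS y0 y1 ^+ 3 != 0.
  by rewrite cubicTS !mulf_neq0 // -opprB oppr_eq0.
have TS0 : cubicT y0 y1 - cubicS y0 y1 != 0.
  by apply: contraNneq TS3 => /subr0_eq ->; rewrite subrr.
have ST0 : cubicS y0 y1 - cubicT y0 y1 != 0 by rewrite -opprB oppr_eq0.
have m0 : m != 0 by rewrite /m /plane_mu mulf_neq0 ?invr_eq0.
have rel : m ^+ 3 * (z1 ^+ 2 - 1) = z0 ^+ 2 - 1.
  by apply: plane_relation => //; exact: theta_sqr.
have z0E : z0 ^+ 2 - 1 != 0.
  have -> : z0 ^+ 2 - 1 =
      4%:R * (y1 ^+ 3 - 1) * (y0 ^+ 3 - 1) / (y0 ^+ 3 - y1 ^+ 3) ^+ 2.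
    by rewrite /z0 /plane_zeta0; field.
  by rewrite !mulf_neq0 // invr_eq0 expf_neq0.
have z1E : z1 ^+ 2 - 1 != 0.
  by apply: contraNneq z0E => z10; rewrite -rel z10 mulr0.
(* [t] will be the coordinate [xi1] of the lift and [m * t] its coordinate [xi0]; the equation of
   the first factor then follows from [rel]. *)
have [t tE] : exists t, t ^+ 3 = (z1 ^+ 2 - 1) / 4%:R.
  have [|t] := closed_rootP ('X^3 - ((z1 ^+ 2 - 1) / 4%:R)%:P) _.
    by rewrite size_XnsubC.
  by rewrite /root !hornerE subr_eq0 => /eqP; exists t.
have t0 : t != 0.
  have : t ^+ 3 != 0 by rewrite tE mulf_neq0 ?invr_eq0.
  by apply: contraNneq => ->; rewrite expr0n.
pose x := [tuple m * t; z0; t; z1].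
have Xx : ExE_chart x.
  have E0 : z0 ^+ 2 = 4%:R * (m * t) ^+ 3 + 1.
    by rewrite [(m * t) ^+ 3]exprMn tE mulrCA [4%:R * _]mulrC divfK // rel subrK.
  have E1 : z1 ^+ 2 = 4%:R * t ^+ 3 + 1 by rewrite tE mulrC divfK // subrK.
  by split.
have val i (lt_i : (i < 4)%N) : has_value a x (nth 0 a i) (nth 0 x i).
  by have := has_value_coord a x (Ordinal lt_i); rewrite !(tnth_nth 0).
have vxi0 : has_value a x xi0 (m * t) := val 0 isT.
have vzeta0 : has_value a x zeta0 z0 := val 1 isT.
have vxi1 : has_value a x xi1 t := val 2 isT.
have vzeta1 : has_value a x zeta1 z1 := val 3 isT.
have vmu : has_value a x mu m.
  by rewrite -[m](mulfK t0); apply: (has_value_div HK).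
have vth : has_value a x thK th by apply: has_value_const.
have v2 : has_value a x 2%:R 2%:R by apply: has_value_nat.
have v2th : has_value a x (2%:R * thK) (2%:R * th) by apply: has_valueM.
have th2_0 : 2%:R * th != 0 by rewrite mulf_neq0 ?theta_neq0.
have v1 : has_value a x 1 1 := has_value_nat a x 1.
have vS : has_value a x (surfS thK mu zeta1) (surfS th m z1).
  rewrite /surfS -[- (mu * _)]sub0r -[- (m * _)]sub0r.
  apply: (has_value_div HK) => //; apply: has_valueB; first exact: (has_value_nat a x 0).
  by apply: has_valueM => //; apply: has_valueD.
have vT : has_value a x (surfT thK mu zeta1) (surfT th m z1).
  apply: (has_value_div HK) => //; apply: has_valueM => //.
  exact: has_valueB.
have vQ : has_value a x (surfQ zeta0) (surfQ z0).
  by apply: (has_value_div HK) => //; apply: has_valueB.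
have vd : has_value a x (surf_den thK mu zeta0 zeta1) (surf_den th m z0 z1).
  by apply: has_valueB; [apply: has_valueX | apply: has_valueM].
have d0 : surf_den th m z0 z1 != 0.
  rewrite surf_den_plane ?theta_neq0 //.
  by rewrite mulf_neq0 // invr_eq0 expf_neq0.
exists x; split=> //.
- rewrite -[y0](surf_u_plane two_neq0 theta_neq0 y01 ST0 den0).
  apply: (has_value_div HK) => //.
  by apply: has_valueD => //; apply: has_valueX.
- rewrite -[y1](surf_v_plane two_neq0 theta_neq0 y01 ST0 den0).
  apply: (has_value_div HK) => //.
  by apply: has_valueD => //; apply: has_valueM.
split; [apply: (has_value_neq0 HK Xx vxi0) | apply: (has_value_neq0 HK Xx vxi1)
  | apply: (has_value_neq0 HK Xx vd)] => //.
exact: mulf_neq0.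
Qed.

(** On the line [y1 = 0] the conditions reduce to [t != 0], [t ^+ 3 != 1] and [t ^+ 3 != - 1]. *)
Lemma good_point_exists : exists t, good_point t 0.
Proof.
have [|t] := closed_nonrootP ('X * ('X^3 - 1%:P) * ('X^3 + 1%:P) : {poly k}) _.
  by rewrite !mulf_neq0 ?polyX_eq0 ?monic_neq0 ?monicXnsubC ?monicXnaddC.
rewrite /root !hornerE !mulf_eq0 !negb_or -andbA => /and3P[t0 t3_1 t31].
exists t; rewrite /good_point /cubicT /cubicS !expr0n /= subr0 expf_neq0 // t3_1.
rewrite sub0r oppr_eq0 oner_neq0 /=.
have -> : (t * 0 + 0 + t ^+ 2) ^+ 2 - (t ^+ 2 * 0 + 0 + t) * - 1 =
  t * (t ^+ 3 + 1) by ring.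
by rewrite mulf_neq0.
Qed.

Lemma surface_neq0 :
  [/\ xi0 != 0, xi1 != 0, surf_den thK mu zeta0 zeta1 != 0 &
      chart_u ^+ 3 - chart_v ^+ 3 != 0].
Proof.
have [t gt] := good_point_exists.
have [x [Xx vu vv [xi00 xi10 d0]]] := good_point_lift gt.
split=> //; have /and4P[t0 _ _ _] := gt.
by apply: (has_value_neq0 HK Xx _ t0); apply: has_valueB; apply: has_valueX.
Qed.

(** The map to the plane is dominant: a relation between the chart functions vanishes at every good
    point, so its product with [H], which vanishes at the other points, is zero everywhere. *)
Lemma chart_free P : gen_eval [tuple chart_u; chart_v] P = 0 -> P = 0.
Proof.
pose X0 : {mpoly k[2]} := 'X_ord0; pose X1 : {mpoly k[2]} := 'X_ord_max.
pose H := (X0 ^+ 3 - X1 ^+ 3) * (X0 ^+ 3 - 1) * (X1 ^+ 3 - 1) *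
  (cubicT X0 X1 ^+ 2 - cubicS X0 X1 * (X1 ^+ 3 - 1)).
have HE y : (H.@[y] != 0) = good_point (y ord0) (y ord_max).
  rewrite /H /good_point /cubicT /cubicS.
  rewrite !(rmorphM, rmorphB, rmorphD, rmorphXn, rmorph1) /= !mevalXU.
  by rewrite !mulf_eq0 !negb_or !andbA.
have H0 : H != 0.
  have [t gt] := good_point_exists.
  have := HE (fun i => if i == ord0 then t else 0); rewrite /= gt.
  by apply: contraTneq => ->; rewrite meval0 eqxx.
move=> P0; suff /eqP : P * H = 0 by rewrite mulf_eq0 (negbTE H0) orbF => /eqP.
apply: mpoly_vanish_eq0 => y; rewrite mevalM.
have [->|] := eqVneq H.@[y] 0; first by rewrite mulr0.
rewrite HE => /good_point_lift[x [Xx vu vv _]].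
suff : has_value a x (gen_eval [tuple chart_u; chart_v] P) P.@[y].
  by rewrite P0 => /(has_value0 HK Xx) ->; rewrite mul0r.
apply: has_value_gen_eval => i; rewrite (tnth_nth 0).
case: i => [[|[|//]] lt_i] /=.
  by have -> : Ordinal lt_i = ord0 by apply: val_inj.
by have -> : Ordinal lt_i = ord_max by apply: val_inj.
Qed.

Let rel : mu ^+ 3 * (zeta1 ^+ 2 - 1) = zeta0 ^+ 2 - 1.
Proof.
have [_ xi10 _ _] := surface_neq0.
by rewrite curve_eq0 curve_eq1 /xi_ratio; field.
Qed.

Let mu_neq0 : mu != 0.
Proof. by have [? ? _ _] := surface_neq0; rewrite mulf_neq0 ?invr_eq0. Qed.

Let two_neq0K := nat_neq0K two_neq0.

Lemma chart_zeta0 : plane_zeta0 chart_u chart_v = zeta0.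
Proof. by have [_ _ d0 uv0] := surface_neq0; apply: plane_zeta0_surf. Qed.

Lemma chart_zeta1 : plane_zeta1 thK chart_u chart_v = zeta1.
Proof. by have [_ _ d0 uv0] := surface_neq0; apply: plane_zeta1_surf. Qed.

Lemma chart_mu : plane_mu chart_u chart_v = mu.
Proof.
have [_ _ d0 uv0] := surface_neq0.
by apply: plane_mu_surf; [exact: two_neq0K | exact: th2K | | exact: rel | |].
Qed.

Lemma chart_cubicST_neq0 : cubicS chart_u chart_v - cubicT chart_u chart_v != 0.
Proof.
have [_ _ d0 uv0] := surface_neq0.
by apply: cubicST_neq0; [exact: two_neq0K | exact: th2K | | exact: rel | | |].
Qed.

Lemma chart_form (D : derivation K) (alpha : k) :
  mu ^+ 2 * D zeta1 - (3%:R^-1 * th * (1 - alpha))%:K * D zeta0 =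
  2%:R * thK / (chart_u ^+ 3 - chart_v ^+ 3) ^+ 2 *
    ((chart_v ^+ 3 - 1) * (chart_v - alpha%:K * chart_u ^+ 2) * D chart_u
     + (1 - chart_u ^+ 3) * (chart_u - alpha%:K * chart_v ^+ 2) * D chart_v).
Proof.
have [_ _ _ uv0] := surface_neq0.
rewrite -(plane_form D th (nat_neq0K three_neq0) uv0 chart_cubicST_neq0).
by rewrite chart_mu chart_zeta0 chart_zeta1.
Qed.

(** The rotation by [w ^+ 2] permutes the points of the chart, with inverse the rotation by [w];
    hence the rotated coordinates satisfy the same relations as the original ones. *)
Lemma order3_morphism :
  exists sigma : kmorph K K, order3_action xi0 zeta0 xi1 zeta1 w sigma.
Proof.
have w3 := cube_root_of_unity w_root.
have w2_3 : (w ^+ 2) ^+ 3 = 1 by rewrite exprAC w3 expr1n.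
pose b := [tuple (w ^+ 2)%:K * xi0; zeta0; (w ^+ 2)%:K * xi1; zeta1].
pose rot (c : k) (x : 4.-tuple k) := [tuple c * x`_0; x`_1; c * x`_2; x`_3].
have rotX c x : c ^+ 3 = 1 -> ExE_chart x -> ExE_chart (rot c x).
  by move=> c3 []; rewrite /ExE_chart /on_E ![(c * _) ^+ 3]exprMn c3 !mul1r.
pose X (i : 'I_4) : {mpoly k[4]} := 'X_i.
pose X_ (j : nat) := X (inord j).
pose tau := [tuple (w ^+ 2)%:MP * X_ 0; X_ 1; (w ^+ 2)%:MP * X_ 2; X_ 3].
pose sub : {rmorphism {mpoly k[4]} -> {mpoly k[4]}} := mmap (@mpolyC 4 k) (tnth tau).
have subC c : sub c%:MP = c%:MP by apply: mmapC.
have subX i : sub 'X_i = tnth tau i by apply: mmapXU.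
have aX j : (j < 4)%N -> gen_eval a (X_ j) = nth 0 a j.
  by move=> lt_j; rewrite gen_evalX (tnth_nth 0) inordK.
have xX (x : 4.-tuple k) j : (j < 4)%N -> (X_ j).@[tnth x] = x`_j.
  by move=> lt_j; rewrite mevalXU (tnth_nth 0) inordK.
have aP P : gen_eval a (sub P) = gen_eval b P.
  apply: (@mpoly_rmorph_eq _ _ _ (gen_eval a \o sub) (gen_eval b)) => [c|i].
    transitivity (gen_eval a (sub c%:MP)) => //.
    by rewrite subC gen_evalC [RHS]gen_evalC.
  transitivity (gen_eval a (sub 'X_i)) => //.
  rewrite subX [RHS]gen_evalX !(tnth_nth 0).
  case: i => [[|[|[|[|//]]]] lt_i]; rewrite /= ?rmorphM ?aX //=.
    by rewrite gen_evalC aX.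
  by rewrite gen_evalC aX.
have xP x P : (sub P).@[tnth x] = P.@[tnth (rot (w ^+ 2) x)].
  apply: (@mpoly_rmorph_eq _ _ _ (meval (tnth x) \o sub)
    (meval (tnth (rot (w ^+ 2) x)))) => [c|i].
    transitivity (sub c%:MP).@[tnth x] => //.
    by rewrite subC mevalC [RHS]mevalC.
  transitivity (sub 'X_i).@[tnth x] => //.
  rewrite subX [RHS]mevalXU !(tnth_nth 0).
  case: i => [[|[|[|[|//]]]] lt_i]; rewrite /= ?rmorphM ?xX //=.
    by rewrite mevalC xX.
  by rewrite mevalC xX.
have [|sigma sE] := function_field_ext HK (b := b).
  move=> P; rewrite -aP !(gen_eval_eq0P HK); split=> P0 x Xx.
    by rewrite xP; apply/P0/rotX.
  have -> : x = rot (w ^+ 2) (rot w x).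
    apply: eq_from_tnth => i; rewrite !(tnth_nth 0).
    by case: i => [[|[|[|[|//]]]] lt_i]; rewrite //= mulrA -exprSr w3 mul1r.
  by rewrite -xP; apply/P0/rotX.
exists sigma; split.
- exact: (sE (Ordinal (isT : 0 < 4)%N)).
- exact: (sE (Ordinal (isT : 1 < 4)%N)).
- exact: (sE (Ordinal (isT : 2 < 4)%N)).
- exact: (sE (Ordinal (isT : 3 < 4)%N)).
Qed.

End Surface.

(** * Compatibility of the formulas with field morphisms *)

Lemma rmorph_plane_zeta0 (F F' : fieldType) (f : {rmorphism F -> F'}) (u v : F) :
  f (plane_zeta0 u v) = plane_zeta0 (f u) (f v).
Proof.
by rewrite /plane_zeta0 fmorph_div rmorphB rmorphD rmorphB !rmorphXn rmorph_nat.
Qed.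

Lemma rmorph_cubicS (F F' : fieldType) (f : {rmorphism F -> F'}) (u v : F) :
  f (cubicS u v) = cubicS (f u) (f v).
Proof. by rewrite /cubicS !rmorphD rmorphM !rmorphXn. Qed.

Lemma rmorph_cubicT (F F' : fieldType) (f : {rmorphism F -> F'}) (u v : F) :
  f (cubicT u v) = cubicT (f u) (f v).
Proof. by rewrite /cubicT !rmorphD rmorphM !rmorphXn. Qed.

Lemma rmorph_plane_zeta1 (F F' : fieldType) (f : {rmorphism F -> F'}) (t u v : F) :
  f (plane_zeta1 t u v) = plane_zeta1 (f t) (f u) (f v).
Proof.
rewrite /plane_zeta1 fmorph_div rmorphM rmorphD rmorphB.
by rewrite !rmorph_cubicS !rmorph_cubicT.
Qed.

Lemma rmorph_plane_mu (F F' : fieldType) (f : {rmorphism F -> F'}) (u v : F) :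
  f (plane_mu u v) = plane_mu (f u) (f v).
Proof.
by rewrite /plane_mu fmorph_div !rmorphB !rmorphXn rmorph_cubicS rmorph_cubicT.
Qed.

Lemma rmorph_surf (F F' : fieldType) (f : {rmorphism F -> F'}) (t m x y : F) :
  f (surf_u t m x y) = surf_u (f t) (f m) (f x) (f y) /\
  f (surf_v t m x y) = surf_v (f t) (f m) (f x) (f y).
Proof.
have fS : f (surfS t m y) = surfS (f t) (f m) (f y).
  by rewrite /surfS fmorph_div rmorphN !rmorphM rmorphD rmorph_nat.
have fT : f (surfT t m y) = surfT (f t) (f m) (f y).
  by rewrite /surfT fmorph_div !rmorphM rmorphB rmorph_nat.
have fQ : f (surfQ x) = surfQ (f x).
  by rewrite /surfQ fmorph_div rmorphB rmorph1 rmorph_nat.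
have fd : f (surf_den t m x y) = surf_den (f t) (f m) (f x) (f y).
  by rewrite /surf_den rmorphB rmorphXn fT rmorphM fS fQ.
rewrite /surf_u /surf_v !fmorph_div fd; split; congr (_ / _).
  by rewrite rmorphD rmorphXn fS fT.
by rewrite rmorphD fQ rmorphM fS fT.
Qed.

Lemma der_curve (k : fieldType) (K : kfield k) (D : derivation K) (xi zeta : K) :
    2%:R != 0 :> K -> zeta ^+ 2 = 4%:R * xi ^+ 3 + 1 ->
  zeta * D zeta = 6%:R * xi ^+ 2 * D xi.
Proof.
move=> two_neq0 /(congr1 D); rewrite derD derM der_nat der1 !derX /= => E.
apply: (mulfI two_neq0); move: E; rewrite expr1 => E.
transitivity (2%:R * zeta * D zeta); first by ring.
by rewrite E; ring.
Qed.

(** * The quotient and its foliations *)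

Section QuotientMap.
Variables (k : closedFieldType) (K : kfield k) (xi0 zeta0 xi1 zeta1 : K).
Hypothesis HK : function_field (@ExE_chart k) [tuple xi0; zeta0; xi1; zeta1].
Hypothesis two_neq0 : 2%:R != 0 :> k.
Hypothesis three_neq0 : 3%:R != 0 :> k.
Variable w : k.
Hypothesis w_root : 1 + w + w ^+ 2 = 0.
Variables (L : kfield k) (u v : L).
Hypothesis HL : function_field (@P2_chart k) [tuple u; v].
Variable sigma : kmorph K K.
Hypothesis sigmaP : order3_action xi0 zeta0 xi1 zeta1 w sigma.

Local Notation a := [tuple xi0; zeta0; xi1; zeta1].
Local Notation th := (1 + 2%:R * w).
Local Notation mu := (xi_ratio xi0 xi1).
Local Notation U := (chart_u xi0 zeta0 xi1 zeta1 w).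
Local Notation V := (chart_v xi0 zeta0 xi1 zeta1 w).

Let nat_neq0K m : m%:R != 0 :> k -> m%:R != 0 :> K.
Proof. by rewrite -(rmorph_nat (@kf_const k K)) kf_const_eq0. Qed.

Let two_neq0K := nat_neq0K two_neq0.
Let three_neq0K := nat_neq0K three_neq0.
Let six_neq0K : 6%:R != 0 :> K.
Proof. by rewrite (natrM _ 2 3) mulf_neq0. Qed.

Let xi0_neq0 : xi0 != 0.
Proof. by case: (surface_neq0 HK two_neq0 three_neq0 w_root). Qed.

Let xi1_neq0 : xi1 != 0.
Proof. by case: (surface_neq0 HK two_neq0 three_neq0 w_root). Qed.

Lemma forall_gens (P : K -> Prop) :
  P xi0 -> P zeta0 -> P xi1 -> P zeta1 -> forall i, P (tnth a i).
Proof. by move=> ? ? ? ? [[|[|[|[|//]]]] lt_i]; rewrite (tnth_nth 0). Qed.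

Lemma sigma_order3 f : sigma (sigma (sigma f)) = f.
Proof.
have [s0 t0 s1 t1] := sigmaP.
have w3 := cube_root_of_unity w_root.
have s3 x : sigma x = (w ^+ 2)%:K * x -> sigma (sigma (sigma x)) = x.
  have sc : sigma (w ^+ 2)%:K = (w ^+ 2)%:K by apply: kmorph_const.
  have : (w ^+ 2)%:K ^+ 3 = 1 :> K by rewrite -rmorphXn exprAC w3 expr1n rmorph1.
  move: (w ^+ 2)%:K sc => c sc c3 sx.
  rewrite sx rmorphM sc sx !rmorphM /= !sc sx.
  by transitivity (c ^+ 3 * x); [ring | rewrite c3 mul1r].
apply: (kmorph_eq HK (f := sigma \o sigma \o sigma) (g := idfun)) => [c|c|] //=.
  by rewrite !kmorph_const.
apply: (@forall_gens (fun f => sigma (sigma (sigma f)) = f)).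
- exact: s3.
- by rewrite !t0.
- exact: s3.
- by rewrite !t1.
Qed.

Lemma sigma_mu : sigma mu = mu.
Proof.
have [s0 _ s1 _] := sigmaP; rewrite fmorph_div s0 s1 -mulf_div divff ?mul1r //.
rewrite kf_const_eq0 expf_neq0 //; apply: contraPneq w_root => ->.
by rewrite expr0n /= !addr0; apply/eqP/oner_neq0.
Qed.

Lemma sigma_chart : sigma U = U /\ sigma V = V.
Proof.
have [_ t0 _ t1] := sigmaP.
have [fu fv] := rmorph_surf sigma th%:K mu zeta0 zeta1.
by rewrite /chart_u /chart_v fu fv sigma_mu t0 t1 /= kmorph_const.
Qed.

(** Both pairs of coordinates are algebraically independent, so they satisfy the same relations. *)
Lemma quotient_map_exists : exists phi : kmorph L K, phi u = U /\ phi v = V.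
Proof.
have [|phi phiE] := function_field_ext HL (b := [tuple U; V]).
  move=> P; split=> [/(affine_free HL)|/(chart_free HK two_neq0 three_neq0 w_root)] ->;
    exact: rmorph0.
exists phi; split; first exact: (phiE (Ordinal (isT : 0 < 2)%N)).
exact: (phiE (Ordinal (isT : 1 < 2)%N)).
Qed.

Variable phi : kmorph L K.
Hypothesis phi_u : phi u = U.
Hypothesis phi_v : phi v = V.

Lemma sigma_phi m : sigma (phi m) = phi m.
Proof.
apply: (kmorph_eq HL (f := sigma \o phi) (g := phi)) => [c|c|] /=.
- by rewrite !kmorph_const.
- by rewrite !kmorph_const.
- have [sU sV] := sigma_chart.
  by move=> [[|[|//]] lt_i]; rewrite !(tnth_nth 0) /= ?phi_u ?phi_v.
Qed.

Let z0 := plane_zeta0 u v.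
Let z1 := plane_zeta1 th%:K u v.
Let m := plane_mu u v.

Let phi_z0 : phi z0 = zeta0.
Proof. by rewrite rmorph_plane_zeta0 phi_u phi_v chart_zeta0. Qed.

Let phi_z1 : phi z1 = zeta1.
Proof. by rewrite rmorph_plane_zeta1 phi_u phi_v /= kmorph_const chart_zeta1. Qed.

Let phi_m : phi m = mu.
Proof. by rewrite rmorph_plane_mu phi_u phi_v chart_mu. Qed.

(** * The function field of E x E as a cubic radical extension of that of the plane *)

Let c := (z1 ^+ 2 - 1) / 4%:R.

Let xi1_cubed : xi1 ^+ 3 = phi c.
Proof.
have four_neq0 : 4%:R != 0 :> K by rewrite (natrM _ 2 2) mulf_neq0.
rewrite /c fmorph_div rmorphB rmorphXn rmorph1 rmorph_nat /= phi_z1.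
by rewrite (curve_eq1 HK); field.
Qed.

(** [zeta0], [zeta1] and [mu] come from [L], and [xi0 = mu * xi1]. *)
Lemma quotient_kummer_gen f : exists m : L * L * L,
  f == kummer_sum phi xi1 m.1.1 m.1.2 m.2.
Proof.
have [_ _ s1 _] := sigmaP.
apply: (function_field_kummer_gen HK w_root sigma_phi s1 xi1_cubed).
apply: (@forall_gens (fun f => exists m : L * L * L,
  f = kummer_sum phi xi1 m.1.1 m.1.2 m.2)); rewrite /kummer_sum.
- exists (0, m, 0); rewrite /= !rmorph0 phi_m /xi_ratio divfK //; ring.
- exists (z0, 0, 0); rewrite /= !rmorph0 phi_z0; ring.
- exists (0, 1, 0); rewrite /= !rmorph0 rmorph1; ring.
- exists (z1, 0, 0); rewrite /= !rmorph0 phi_z1; ring.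
Qed.

Lemma quotient_invariant f : sigma f = f -> exists m, phi m = f.
Proof.
have [_ _ s1 _] := sigmaP.
exact: (invariant_in_image three_neq0 w_root sigma_phi s1 quotient_kummer_gen).
Qed.

Lemma quotient_derivation_ext (D : derivation L) :
  exists D' : derivation K, forall m, D' (phi m) = phi (D m).
Proof.
have [_ _ s1 _] := sigmaP.
exact: (derivation_ext three_neq0 w_root sigma_phi s1 xi1_neq0 xi1_cubed
  quotient_kummer_gen).
Qed.

Lemma plane_partials : exists Du Dv : derivation L,
  [/\ Du u = 1, Du v = 0, Dv u = 0 & Dv v = 1].
Proof.
have [Du DuE] := partial_exists HL (affine_free HL) (Ordinal (isT : 0 < 2)%N).
have [Dv DvE] := partial_exists HL (affine_free HL) (Ordinal (isT : 1 < 2)%N).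
exists Du, Dv; split.
- exact: (DuE (Ordinal (isT : 0 < 2)%N)).
- exact: (DuE (Ordinal (isT : 1 < 2)%N)).
- exact: (DvE (Ordinal (isT : 0 < 2)%N)).
- exact: (DvE (Ordinal (isT : 1 < 2)%N)).
Qed.

Lemma der_xi0 (D : derivation K) : D xi0 = zeta0 * D zeta0 / (6%:R * xi0 ^+ 2).
Proof.
rewrite (der_curve D two_neq0K (curve_eq0 HK)) mulrC mulKf //.
by rewrite mulf_neq0 ?expf_neq0.
Qed.

Lemma der_xi1 (D : derivation K) : D xi1 = zeta1 * D zeta1 / (6%:R * xi1 ^+ 2).
Proof.
rewrite (der_curve D two_neq0K (curve_eq1 HK)) mulrC mulKf //.
by rewrite mulf_neq0 ?expf_neq0.
Qed.

(** The equation of E recovers the values at [xi0] and [xi1]. Unlike these, [zeta0] and [zeta1] are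
    invariant under [sigma], hence suited to the quotient. *)
Lemma derivation_eq_zeta (D D' : derivation K) :
  D zeta0 = D' zeta0 -> D zeta1 = D' zeta1 -> D =1 D'.
Proof.
move=> eq0 eq1; apply: (derivation_eq HK).
apply: (@forall_gens (fun f => D f = D' f)) => //.
  by rewrite !der_xi0 eq0.
by rewrite !der_xi1 eq1.
Qed.

(* Were the matrix of the values of two independent derivations at zeta0 and  *)
(* zeta1 singular, a nontrivial combination of them would vanish identically. *)
Lemma derivation_zeta (p q : K) :
  exists D : derivation K, D zeta0 = p /\ D zeta1 = q.
Proof.
have [Du [Dv [Duu Duv Dvu Dvv]]] := plane_partials.
have [E1 E1E] := quotient_derivation_ext Du.
have [E2 E2E] := quotient_derivation_ext Dv.
have E1U : E1 U = 1 by rewrite -phi_u E1E Duu rmorph1.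
have E1V : E1 V = 0 by rewrite -phi_v E1E Duv rmorph0.
have E2U : E2 U = 0 by rewrite -phi_u E2E Dvu rmorph0.
have E2V : E2 V = 1 by rewrite -phi_v E2E Dvv rmorph1.
have [Z ZE] := der_lin_comb 0 0 E1 E1.
have Z0 f : Z f = 0 by rewrite ZE !mul0r addr0.
have free h1 h2 : h1 * E1 zeta0 + h2 * E2 zeta0 = 0 ->
    h1 * E1 zeta1 + h2 * E2 zeta1 = 0 -> h1 = 0 /\ h2 = 0.
  have [D DE] := der_lin_comb h1 h2 E1 E2.
  rewrite -!DE => D0 D1; have DZ : D =1 Z by apply: derivation_eq_zeta; rewrite Z0.
  have := DZ U; have := DZ V; rewrite !DE !Z0 E1U E1V E2U E2V !mulr1 !mulr0.
  by rewrite addr0 add0r.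
pose d := E1 zeta0 * E2 zeta1 - E2 zeta0 * E1 zeta1.
have d0 : d != 0.
  apply/eqP => d0.
  have [E20 /eqP] : E2 zeta0 = 0 /\ - E1 zeta0 = 0.
    by apply: free; [ring | rewrite -oppr0 -d0 /d; ring].
  rewrite oppr_eq0 => /eqP E10.
  have [E21 /eqP] : E2 zeta1 = 0 /\ - E1 zeta1 = 0.
    by apply: free; [rewrite E20 E10; ring | ring].
  rewrite oppr_eq0 => /eqP E11.
  have [/eqP] : (1 : K) = 0 /\ (0 : K) = 0.
    by apply: free; rewrite ?E10 ?E11 ?E20 ?E21; ring.
  by rewrite oner_eq0.
have [D DE] := der_lin_comb ((p * E2 zeta1 - q * E2 zeta0) / d)
  ((q * E1 zeta0 - p * E1 zeta1) / d) E1 E2.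
by exists D; rewrite !DE; move: d0; rewrite /d => d0; split; field.
Qed.

(** * The foliation on E x E *)

Variable lambda : k.
Let G := foliation_G xi0 zeta0 xi1 zeta1 lambda.

Lemma foliation_G_generator : exists D0 D1 : derivation K,
  [/\ induced_by_DE xi0 zeta0 xi1 zeta1 D0, induced_by_DE xi1 zeta1 xi0 zeta0 D1,
      (D0 zeta0 = 6%:R * xi0 ^+ 2) & (D1 zeta1 = 6%:R * xi1 ^+ 2)].
Proof.
have [D0 [D00 D01]] := derivation_zeta (6%:R * xi0 ^+ 2) 0.
have [D1 [D10 D11]] := derivation_zeta 0 (6%:R * xi1 ^+ 2).
exists D0, D1; split=> //.
  split=> //; last by rewrite der_xi1 D01 mulr0 mul0r.
  by rewrite der_xi0 D00 mulfK // mulf_neq0 ?expf_neq0.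
split=> //; last by rewrite der_xi0 D10 mulr0 mul0r.
by rewrite der_xi1 D11 mulfK // mulf_neq0 ?expf_neq0.
Qed.

Let zeta0_neq0 : zeta0 != 0.
Proof.
have [D [D0 _]] := derivation_zeta 1 0.
by apply: contra_eq_neq D0 => ->; rewrite der0 eq_sym oner_neq0.
Qed.

Let zeta1_neq0 : zeta1 != 0.
Proof.
have [D [_ D1]] := derivation_zeta 0 1.
by apply: contra_eq_neq D1 => ->; rewrite der0 eq_sym oner_neq0.
Qed.

Lemma induced_zeta0 D : induced_by_DE xi0 zeta0 xi1 zeta1 D ->
  D zeta0 = 6%:R * xi0 ^+ 2 /\ D zeta1 = 0.
Proof.
case=> D0 _ D1; split=> //; apply: (mulfI zeta0_neq0).
by rewrite (der_curve D two_neq0K (curve_eq0 HK)) D0 mulrC.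
Qed.

Lemma induced_zeta1 D : induced_by_DE xi1 zeta1 xi0 zeta0 D ->
  D zeta0 = 0 /\ D zeta1 = 6%:R * xi1 ^+ 2.
Proof.
case=> D1 _ D0; split=> //; apply: (mulfI zeta1_neq0).
by rewrite (der_curve D two_neq0K (curve_eq1 HK)) D1 mulrC.
Qed.

(** The generator takes the values [6 xi0 ^+ 2] and [6 lambda xi1 ^+ 2] at [zeta0] and [zeta1]; the
    equation says that those of [D] are proportional to them. *)
Lemma foliation_GP D : G D <-> mu ^+ 2 * D zeta1 = lambda%:K * D zeta0.
Proof.
split=> [[D0 [D1 [/induced_zeta0[D00 D01] /induced_zeta1[D10 D11] [h DE]]]]|DE].
  by rewrite !DE D00 D01 D10 D11 /xi_ratio; field.
have [D0 [D1 [ind0 ind1]]] := foliation_G_generator.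
have [[D00 D01] [D10 D11]] := (induced_zeta0 ind0, induced_zeta1 ind1) => _ _.
(* The multiplier is forced by the value at [zeta0]. *)
exists D0, D1; split=> //; pose h := D zeta0 / (6%:R * xi0 ^+ 2); exists h.
have [E EE] := der_lin_comb h (h * lambda%:K) D0 D1.
have D1E : D zeta1 = lambda%:K * D zeta0 / mu ^+ 2.
  by rewrite -DE mulrC mulKf // expf_neq0 // mulf_neq0 ?invr_eq0.
move=> f; rewrite mulrDr mulrA -EE; apply: derivation_eq_zeta.
  by rewrite EE D00 D10 /h; field; rewrite xi0_neq0 six_neq0K.
by rewrite EE D01 D11 D1E /h /xi_ratio; field; rewrite xi0_neq0 xi1_neq0 six_neq0K.
Qed.

Lemma foliation_G_foliation : is_foliation G.
Proof.
have [D0 [D1 [ind0 ind1]]] := foliation_G_generator.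
have [[D00 D01] [D10 D11]] := (induced_zeta0 ind0, induced_zeta1 ind1) => _ _.
have [E EE] := der_lin_comb 1 lambda%:K D0 D1.
have E0 : E zeta0 = 6%:R * xi0 ^+ 2 by rewrite EE D00 D10; ring.
exists E; first by exists zeta0; rewrite E0 mulf_neq0 ?expf_neq0.
have EE' f : E f = D0 f + lambda%:K * D1 f by rewrite EE mul1r.
move=> D; split=> [/foliation_GP DE|[h DE]]; last first.
  by exists D0, D1; split=> //; exists h => f; rewrite DE EE'.
have [D0' [D1' [ind0' ind1' [h DE']]]] := (foliation_GP D).2 DE.
exists h => f; rewrite DE' EE'.
have [[D00' D01'] [D10' D11']] := (induced_zeta0 ind0', induced_zeta1 ind1').
congr (h * (_ + _ * _)); apply: derivation_eq_zeta.
- by rewrite D00 D00'.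
- by rewrite D01 D01'.
- by rewrite D10 D10'.
- by rewrite D11 D11'.
Qed.

(** The equation of [foliation_GP] involves only the invariants [mu], [zeta0], [zeta1] and a
    constant. *)
Lemma sigma_transports : transports sigma G G.
Proof.
split; first by exists (sigma \o sigma) => f; rewrite /= sigma_order3.
have [_ t0 _ t1] := sigmaP => D D' DD'.
have D0 : D' zeta0 = sigma (D zeta0) by rewrite -DD' t0.
have D1 : D' zeta1 = sigma (D zeta1) by rewrite -DD' t1.
have mE : mu ^+ 2 * D' zeta1 = sigma (mu ^+ 2 * D zeta1).
  by rewrite rmorphM rmorphXn sigma_mu D1.
have lE : lambda%:K * D' zeta0 = sigma (lambda%:K * D zeta0).
  by rewrite rmorphM D0 /= kmorph_const.
rewrite !foliation_GP mE lE; split=> [->//|]; exact: fmorph_inj.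
Qed.

(** The conjugate [C] of [D] by [sigma] again belongs to [G], and [D (sigma f) = sigma (C f)]. Here
    [s2] is the inverse of [sigma]. *)
Lemma foliation_G_sigma f : (forall D, G D -> D f = 0) ->
  forall D, G D -> D (sigma f) = 0.
Proof.
move=> f0 D GD; pose s2 x := sigma (sigma x).
have CD x y : s2 (D (sigma (x + y))) = s2 (D (sigma x)) + s2 (D (sigma y)).
  by rewrite /s2 rmorphD derD !rmorphD.
have CM x y : s2 (D (sigma (x * y))) =
    x * s2 (D (sigma y)) + y * s2 (D (sigma x)).
  by rewrite /s2 rmorphM derM !rmorphD !rmorphM /= !sigma_order3.
have CC b : s2 (D (sigma b%:K)) = 0.
  by rewrite /s2 kmorph_const der_const !rmorph0.
pose C := Derivation CD CM CC.
have CE x : D (sigma x) = sigma (C x) by rewrite /= /s2 sigma_order3.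
by rewrite CE f0 ?rmorph0 //; apply/(sigma_transports.2 C D CE).
Qed.

(** * The foliation on the plane and its pull-back *)

Variable alpha : k.
Hypothesis lambdaE : lambda = 3%:R^-1 * th * (1 - alpha).
Let F := foliation_F4 u v alpha.

Let A := (v ^+ 3 - 1) * (v - alpha%:K * u ^+ 2).
Let B := (1 - u ^+ 3) * (u - alpha%:K * v ^+ 2).

Lemma foliation_FP D : F D <-> A * D u + B * D v = 0.
Proof.
by rewrite /F /foliation_F4 der1 mulr0 addr0 !expr1n !mulr1.
Qed.

Lemma formA_neq0 : A != 0.
Proof.
pose X0 : {mpoly k[2]} := 'X_(Ordinal (isT : 0 < 2)%N).
pose X1 : {mpoly k[2]} := 'X_(Ordinal (isT : 1 < 2)%N).
pose P := (X1 ^+ 3 - 1) * (X1 - alpha%:MP * X0 ^+ 2).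
have PE : gen_eval [tuple u; v] P = A.
  rewrite /P rmorphM rmorphB rmorphXn rmorph1 rmorphB rmorphM rmorphXn.
  rewrite /= gen_evalC !gen_evalX.
  by rewrite !(tnth_nth 0).
(* At this point the form has first coefficient (-2)(-1) = 2, whatever [alpha] is. *)
pose x := [tuple 0; -1 : k].
have : P.@[tnth x] = 2%:R.
  rewrite /P rmorphM rmorphB rmorphXn rmorph1 rmorphB rmorphM rmorphXn.
  rewrite /= mevalC !mevalXU.
  by rewrite !(tnth_nth 0) /=; ring.
move=> P2; apply: contraNneq two_neq0 => A0; rewrite -P2.
by apply/eqP; apply: (gen_eval_eq0P HL P).1; rewrite // PE.
Qed.

Lemma foliation_GP_chart D : G D <-> phi A * D U + phi B * D V = 0.
Proof.
have [_ _ _ uv0] := surface_neq0 HK two_neq0 three_neq0 w_root.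
have th0 : th%:K != 0 :> K by rewrite kf_const_eq0 theta_neq0.
have phiA : phi A = (V ^+ 3 - 1) * (V - alpha%:K * U ^+ 2).
  rewrite /A rmorphM rmorphB rmorphXn rmorph1 rmorphB rmorphM rmorphXn.
  by rewrite /= kmorph_const phi_u phi_v.
have phiB : phi B = (1 - U ^+ 3) * (U - alpha%:K * V ^+ 2).
  rewrite /B rmorphM rmorphB rmorph1 rmorphXn rmorphB rmorphM rmorphXn.
  by rewrite /= kmorph_const phi_u phi_v.
have := chart_form HK two_neq0 three_neq0 w_root D alpha.
rewrite -phiA -phiB -lambdaE foliation_GP => E.
have c0 : 2%:R * th%:K / (U ^+ 3 - V ^+ 3) ^+ 2 != 0.
  by rewrite !mulf_neq0 // invr_eq0 expf_neq0.
split=> [GE|FE]; last by apply/subr0_eq; rewrite E FE mulr0.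
by apply: (mulfI c0); rewrite -E GE subrr mulr0.
Qed.

Lemma foliation_F_iff_G (D : derivation L) (D' : derivation K) :
  (forall x, D' (phi x) = phi (D x)) -> F D <-> G D'.
Proof.
move=> DD'; rewrite foliation_GP_chart foliation_FP -phi_u -phi_v !DD'.
rewrite -!rmorphM -rmorphD; split=> [->|/eqP]; first exact: rmorph0.
by rewrite fmorph_eq0 => /eqP.
Qed.

Lemma foliation_F_generator : exists2 D0 : derivation L,
  (D0 u = B) & (D0 v = - A).
Proof.
have [Du [Dv [Duu Duv Dvu Dvv]]] := plane_partials.
have [D0 D0E] := der_lin_comb B (- A) Du Dv.
by exists D0; rewrite D0E ?Duu ?Duv ?Dvu ?Dvv; ring.
Qed.

Lemma plane_derivation_eq (D D' : derivation L) :
  D u = D' u -> D v = D' v -> D =1 D'.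
Proof.
move=> Eu Ev; apply: (derivation_eq HL) => -[[|[|//]] lt_i];
  by rewrite !(tnth_nth 0).
Qed.

Lemma foliation_F_foliation : is_foliation F.
Proof.
have [D0 D0u D0v] := foliation_F_generator; have A0 := formA_neq0.
exists D0; first by exists v; rewrite D0v oppr_eq0.
move=> D; rewrite foliation_FP; split=> [E|[h DE]]; last first.
  by rewrite !DE D0u D0v; ring.
pose h := - D v / A; exists h.
have [hD hDE] := der_lin_comb h 0 D0 D0.
move=> f; have -> : h * D0 f = hD f by rewrite hDE mul0r addr0.
apply: plane_derivation_eq; rewrite hDE mul0r addr0 ?D0u ?D0v /h.
  apply: (mulfI A0); move/eqP: E; rewrite addr_eq0 => /eqP ->; field.
  exact: A0.
by field; exact: A0.
Qed.

(** [phi] is an isomorphism of [L] onto the invariant field. A derivation in [F] extends to [K], and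
    by [foliation_F_iff_G] its extension is tangent to [G]; conversely any lift tangent to [G] gives
    back [F]. *)
Lemma birational_F_quotient :
  birationally_equivalent F (quotient_foliation (s := sigma) G).
Proof.
have inv x : phi x \in Defs.invariant sigma by rewrite inE sigma_phi.
pose q x : quotient_kfield sigma := QuotientField (inv x).
have qZ : zmod_morphism q by move=> x y; apply: val_inj; rewrite /= rmorphB.
have qM : monoid_morphism q.
  by split=> [|x y]; apply: val_inj; rewrite /= ?rmorph1 ?rmorphM.
pose qZ' := GRing.isZmodMorphism.Build L (quotient_kfield sigma) q qZ.
pose qM' := GRing.isMonoidMorphism.Build L (quotient_kfield sigma) q qM.
pose qr : {rmorphism L -> quotient_kfield sigma} := HB.pack q qZ' qM'.
have qC b : qr b%:K = b%:K by apply: val_inj; rewrite /= kmorph_const.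
have q_surj y : exists x, q x == y.
  have /eqP/quotient_invariant[x xE] := valP y.
  by exists x; apply/eqP/val_inj.
exists (KMorph qC); split.
  exists (fun y => xchoose (q_surj y)) => [x|y]; last exact: eqP (xchooseP (q_surj y)).
  exact: (fmorph_inj qr (eqP (xchooseP (q_surj (q x))))).
move=> D D' /= DD'; split=> [FD|[E GE EE]].
  have [E EE] := quotient_derivation_ext D.
  exists E; first exact/(foliation_F_iff_G EE).
  move=> y; have /eqP <- := xchooseP (q_surj y).
  by rewrite DD' EE.
apply/(foliation_F_iff_G (D' := E)) => // x.
by have := EE (q x); rewrite DD'.
Qed.

(** * First integrals *)

Lemma chain_rule_phi (Du Dv : derivation L) (D : derivation K) x :
    [/\ Du u = 1, Du v = 0, Dv u = 0 & Dv v = 1] ->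
  D (phi x) = phi (Du x) * D U + phi (Dv x) * D V.
Proof.
case=> Duu Duv Dvu Dvv; apply/eqP; rewrite -subr_eq0; apply/eqP; move: x.
apply: (derivation_along_eq0 HL (phi := phi)) => [f g|f g|b|i].
- by rewrite !(rmorphD, derD); ring.
- by rewrite rmorphM !derM !rmorphD !rmorphM /=; ring.
- by rewrite kmorph_const !der_const rmorph0; ring.
- case: i => [[|[|//]] lt_i]; rewrite !(tnth_nth 0) /=.
    by rewrite Duu Dvu rmorph0 rmorph1 phi_u; ring.
  by rewrite Duv Dvv rmorph0 rmorph1 phi_v; ring.
Qed.

(** The differential of [x] and the form [A du + B dv] both vanish on the generator of [F], hence
    are proportional; [D1] shows that the factor is not zero. *)
Lemma first_integral_form x (D1 : derivation K) :
    (forall D, F D -> D x = 0) -> D1 (phi x) != 0 ->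
  exists2 h : L, h != 0 & forall D : derivation K,
    D (phi x) = phi h * (phi A * D U + phi B * D V).
Proof.
move=> x0 D1x; have [Du [Dv DuvE]] := plane_partials.
have A0 := formA_neq0; have [D0 D0u D0v] := foliation_F_generator.
have [E EE] := der_lin_comb B (- A) Du Dv.
have [Duu Duv Dvu Dvv] := DuvE.
have : E x = 0.
  by apply/x0/foliation_FP; rewrite !EE Duu Duv Dvu Dvv; ring.
rewrite EE mulNr => /subr0_eq BA.
have DvE : Dv x = Du x / A * B by rewrite mulrAC [Du x * B]mulrC BA mulrC mulKf.
have xE (D : derivation K) : D (phi x) = phi (Du x / A) * (phi A * D U + phi B * D V).
  rewrite (chain_rule_phi _ _ DuvE) DvE [phi (_ * B)]rmorphM mulrDr !mulrA.
  by congr (_ * _ + _); rewrite -rmorphM divfK.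
exists (Du x / A) => //.
by apply: contraNneq D1x => h0; rewrite xE h0 rmorph0 mul0r.
Qed.

Lemma algebraically_integrable_F_G :
  algebraically_integrable F <-> algebraically_integrable G.
Proof.
split=> [[f [[D Df] FE]]|[f [[D Df] GE]]].
  have [D' D'E] := quotient_derivation_ext D.
  have D'f : D' (phi f) != 0 by rewrite D'E fmorph_eq0.
  have [h h0 hE] := first_integral_form (fun D => (FE D).1) D'f.
  exists (phi f); split; first by exists D'.
  move=> C; rewrite foliation_GP_chart hE; split=> [->|/eqP]; first exact: mulr0.
  by rewrite mulf_eq0 fmorph_eq0 (negbTE h0) => /eqP.
have W2 := kf_const_root K w_root.
pose W : K := w%:K; pose t c1 c2 := f + c1 * sigma f + c2 * sigma (sigma f).
have Gf C : G C -> C f = 0 by move/GE.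
have Gs := foliation_G_sigma Gf; have Gss := foliation_G_sigma Gs.
have DW (C : derivation K) : C W = 0 by apply: der_const.
(* The three resolvents add up to [3 * f], so [D] cannot kill them all. As [sigma] multiplies each
   by a cube root of unity, the cubes are invariant. *)
have [c1 [c2 [Dt st Gt]]] : exists c1 c2, [/\ D (t c1 c2) != 0,
    sigma (t c1 c2 ^+ 3) = t c1 c2 ^+ 3 & forall C, G C -> C (t c1 c2) = 0].
  have sW : sigma W = W by apply: kmorph_const.
  have tG c1 c2 : (forall C : derivation K, C c1 = 0) ->
      (forall C : derivation K, C c2 = 0) -> forall C, G C -> C (t c1 c2) = 0.
    move=> c10 c20 C GC; rewrite /t !derD !derM c10 c20 Gf // Gs // Gss //; ring.
  have DW2 (C : derivation K) : C (- 1 - W) = 0 by rewrite derB derN der1 DW; ring.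
  have [T0|T0] := eqVneq (D (t 1 1)) 0; last first.
    exists 1, 1; split=> //; last by apply: tG => C; apply: der1.
    by rewrite rmorphXn /t !rmorphD !rmorphM rmorph1 sigma_order3; ring.
  have [T1|T1] := eqVneq (D (t W (- 1 - W))) 0; last first.
    exists W, (- 1 - W); split=> //; last exact: tG.
    rewrite rmorphXn /t !rmorphD !rmorphM rmorphB rmorphN rmorph1 sW sigma_order3 /=.
    by ring: W2.
  exists (- 1 - W), W; split=> //; last exact: tG.
    apply: contraNneq Df => T2; apply/eqP/(mulfI three_neq0K).
    have -> : 3%:R * D f = D (t 1 1 + t W (- 1 - W) + t (- 1 - W) W).
      rewrite (_ : _ + _ + _ = 3%:R * f); first by rewrite derM der_nat; ring.
      by rewrite /t; ring.
    by rewrite derD T2 derD T0 T1; ring.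
  rewrite rmorphXn /t !rmorphD !rmorphM rmorphB rmorphN rmorph1 sW sigma_order3 /=.
  by ring: W2.
have [g gE] := quotient_invariant st.
(* The derivative of the cube is [3 t ^+ 2 * D t], where [t] is nonzero because [D t] is. *)
have Dg : D (phi g) != 0.
  rewrite gE derX mulf_neq0 // mulf_neq0 // expf_neq0 //.
  by apply: contraNneq Dt => ->; rewrite der0.
have Fg C : F C -> C g = 0.
  move=> FC; have [C' C'E] := quotient_derivation_ext C.
  have GC' : G C' by apply/(foliation_F_iff_G C'E).
  apply/eqP; rewrite -(fmorph_eq0 phi) -C'E gE derX Gt // mulr0 //.
have [h h0 hE] := first_integral_form Fg Dg.
exists g; split.
  have [Du [Dv DuvE]] := plane_partials.
  (* [D] acts on [K], while a derivation of [L] is required; by the chain rule some partial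
     derivative of [g] is nonzero. *)
  have [Du0|] := eqVneq (Du g) 0; last by exists Du.
  exists Dv; apply: contraNneq Dg => Dv0.
  by rewrite (chain_rule_phi _ _ DuvE) Du0 Dv0 !rmorph0 !mul0r addr0.
move=> C; split=> [/Fg//|Cg].
have [C' C'E] := quotient_derivation_ext C.
apply/(foliation_F_iff_G C'E)/foliation_GP_chart.
have /eqP : C' (phi g) = 0 by rewrite C'E Cg rmorph0.
by rewrite hE mulf_eq0 fmorph_eq0 (negbTE h0) => /eqP.
Qed.

End QuotientMap.

Theorem theorem6p7 (k : closedFieldType) (p : nat)
    (char_k : p \in [pchar k]) (p_gt3 : (3 < p)%N)
    (* the function field of P^2 *)
    (L : kfield k) (u v : L)
    (HL : function_field (@P2_chart k) [tuple u; v])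
    (* the function field of E x E *)
    (K : kfield k) (xi0 zeta0 xi1 zeta1 : K)
    (HK : function_field (@ExE_chart k) [tuple xi0; zeta0; xi1; zeta1])
    (alpha omega : k) (omega_prim : 3.-primitive_root omega) :
  let lambda : k := 3%:R^-1 * (1 + 2%:R * omega) * (1 - alpha) in
  let F := foliation_F4 u v alpha in
  let G := foliation_G xi0 zeta0 xi1 zeta1 lambda in
  [/\ is_foliation F,
      is_foliation G,
      exists sigma : kmorph K K,
        [/\ order3_action xi0 zeta0 xi1 zeta1 omega sigma,
            forall f, sigma (sigma (sigma f)) = f,
            transports sigma G G &
            birationally_equivalent F (quotient_foliation (s := sigma) G)] &
      algebraically_integrable F <-> algebraically_integrable G].
Proof.
move=> lambda F G.
have small m : (0 < m < p)%N -> m%:R != 0 :> k.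
  by case/andP=> m_gt0 m_ltp; rewrite -(dvdn_pcharf char_k) gtnNdvd.
have two_neq0 : 2%:R != 0 :> k by rewrite small // (leq_trans _ p_gt3).
have three_neq0 : 3%:R != 0 :> k by rewrite small.
have w_root : 1 + omega + omega ^+ 2 = 0.
  have w1 : omega - 1 != 0.
    rewrite subr_eq0; apply: contraTneq omega_prim => ->.
    by apply/negP => /prim_order_dvd/(_ 1%N); rewrite expr1n eqxx.
  apply: (mulfI w1); rewrite mulr0; transitivity (omega ^+ 3 - 1); first by ring.
  by rewrite (prim_expr_order omega_prim) subrr.
have [sigma sP] := order3_morphism HK w_root.
have [phi [phi_u phi_v]] :=
  quotient_map_exists HK two_neq0 three_neq0 w_root HL.
split.
- exact: foliation_F_foliation.
- exact: (foliation_G_foliation HK two_neq0 three_neq0 w_root HL sP phi_u phi_v).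
- exists sigma; split=> //.
  + exact: (sigma_order3 HK w_root sP).
  + exact: (sigma_transports HK two_neq0 three_neq0 w_root HL sP phi_u phi_v).
  + exact: (birational_F_quotient HK two_neq0 three_neq0 w_root HL sP phi_u phi_v).
- exact: (algebraically_integrable_F_G HK two_neq0 three_neq0 w_root HL sP phi_u phi_v).
Qed.
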